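(* Let $d\ge2$, $Y=[0,1]^d$, and $u\in C^3(\mathbb R^d)$ such that $\nabla u$ is $Y$-periodic. Let $X$ be the gradient flow $\partial_tX(t,x)=\nabla u(X(t,x))$, $X(0,x)=x$, and assume that for almost every $x\in\mathbb R^d$, the set $\{X(t,x):t\ge0\}$ or the set $\{X(t,x):t\le0\}$ is bounded in $\mathbb R^d$. (i) Assume that $\Delta u(x)=0$ for every $x\in\mathbb R^d$ with $\nabla u(x)=0$, and that there is a constant $C>0$ with $$\Big|\int_0^t\Delta u\big(X(s,x)\big)\,ds\Big|\le C\quad\text{for all } t\ge0,\ x\in\mathbb R^d.$$ Then there exists a positive $Y$-periodic function $\sigma$ with $\sigma,\sigma^{-1}\in L^\infty(\mathbb R^d)$ such that $\mathrm{div}(\sigma\nabla u)=0$ in the sense of distributions on $\mathbb R^d$. (ii) Conversely, if there is a positive $Y$-periodic $\sigma\in C^1(\mathbb R^d)$ with $\mathrm{div}(\sigma\nabla u)=0$ in $\mathbb R^d$, then $\Delta u(x)=0$ at every critical point $x$ of $u$, and there is $C>0$ with $\big|\int_0^t\Delta u(X(s,x))\,ds\big|\le C$ for all $t\ge0$, $x\in\mathbb R^d$. *)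

(* Defs.v *)
From HB Require Import structures.
From mathcomp Require Import all_boot all_order all_algebra.
From mathcomp Require Import all_classical all_reals all_analysis.

Set Implicit Arguments.
Unset Strict Implicit.
Unset Printing Implicit Defensive.

Import Order.TTheory GRing.Theory Num.Theory.
Import numFieldNormedType.Exports.

Local Open Scope classical_set_scope.
Local Open Scope ring_scope.

Section Defs.
Variables (R : realType) (d : nat).

Definition coord (x : 'rV[R]_d) (i : 'I_d) : R := x ord0 i.

Definition evec (i : 'I_d) : 'rV[R]_d := delta_mx ord0 i.

Definition partial (i : 'I_d) (f : 'rV[R]_d -> R) : 'rV[R]_d -> R :=
  fun x => 'D_(evec i) f x.

Fixpoint Ck (k : nat) (f : 'rV[R]_d -> R) : Prop :=
  match k with
  | 0 => continuous f
  | k'.+1 => continuous f /\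
      forall i : 'I_d, (forall x, derivable f x (evec i)) /\ Ck k' (partial i f)
  end.

Definition Cinf (f : 'rV[R]_d -> R) : Prop := forall k, Ck k f.

Definition compact_support (f : 'rV[R]_d -> R) : Prop :=
  exists M : R, forall x, M < `|x| -> f x = 0.

Definition grad (f : 'rV[R]_d -> R) (x : 'rV[R]_d) : 'rV[R]_d :=
  \row_(i < d) partial i f x.

Definition laplacian (f : 'rV[R]_d -> R) (x : 'rV[R]_d) : R :=
  \sum_(i < d) partial i (partial i f) x.

Definition dotv (v w : 'rV[R]_d) : R := \sum_(i < d) v ord0 i * w ord0 i.

(* Y-periodicity, Y = [0,1]^d : invariance under the translations by e_i
   (hence under all of Z^d) *)
Definition Yperiodic {V : Type} (f : 'rV[R]_d -> V) : Prop :=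
  forall (i : 'I_d) (x : 'rV[R]_d), f (x + evec i) = f x.

Definition box (a b : 'rV[R]_d) : set 'rV[R]_d :=
  [set x | forall i : 'I_d, coord a i < coord x i <= coord b i].

Definition boxes : set (set 'rV[R]_d) :=
  [set B | exists a b, B = box a b].

(* R^d with the sigma-algebra generated by boxes, i.e. the Borel sets *)
Definition Rd_meas := g_sigma_algebraType boxes.

(* mu is the d-dimensional Lebesgue measure (on Borel sets): it gives each
   box its volume.  This determines mu uniquely. *)
Definition is_lebesgue_Rd (mu : {measure set Rd_meas -> \bar R}) : Prop :=
  forall a b : 'rV[R]_d, (forall i, coord a i <= coord b i) ->
    mu (box a b : set Rd_meas) = (\prod_(i < d) (coord b i - coord a i))%:E.

Definition is_gradient_flow (u : 'rV[R]_d -> R)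
    (X : R -> 'rV[R]_d -> 'rV[R]_d) : Prop :=
  forall x : 'rV[R]_d, X 0 x = x /\
    forall t : R, is_derive t 1 (fun s => X s x) (grad u (X t x)).

End Defs.

(* Main.v *)
Require Import Defs.
From HB Require Import structures.
From mathcomp Require Import all_boot all_order all_algebra.
From mathcomp Require Import all_classical all_reals all_analysis.
From mathcomp Require Import measurable_realfun ring lra.
Import Order.TTheory GRing.Theory Num.Theory.
Import numFieldNormedType.Exports.
Local Open Scope classical_set_scope.
Local Open Scope ring_scope.
Set Implicit Arguments.
Unset Strict Implicit.
Unset Printing Implicit Defensive.

(** Let [J_t x = exp (int_0^t Lap u (X s x) ds)], the Jacobian of the flow.
    For (i), [sigma x = limsup_(t -> +oo) J_t x] is bounded above and below, and
    the cocycle identity [J_(t+s) x = J_s x * J_t (X s x)] gives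
    [sigma (X s x) * J_s x = sigma x].  By Liouville's formula
    [int g (X s x) J_s x dx = int g], the integral of [sigma * (phi o X_(-s))]
    does not depend on [s >= 0]; its derivative at [s = 0] is
    [- int sigma * (grad u . grad phi)].

    Liouville's formula is obtained without differentiating the flow in [x].
    A shear [x |-> x + h c(x) e_i] satisfies the change of variables formula
    exactly, by the fundamental theorem of calculus in the [i]-th coordinate and
    the translation invariance of Lebesgue measure.  Composing the shears of all
    coordinates approximates [X_h] up to [O(h^2)], uniformly over Lipschitz test
    functions with given bounds, so that splitting [[0, t]] into [n] steps
    leaves an error [O(1/n)].

    For (ii), [div (sigma grad u) = 0] says that [ln (sigma (X t x))] has
    derivative [- Lap u (X t x)]. *)

(** The density is only measurable, so the one function ever differentiated is the test function,
    and only along orbits. A limit superior is taken because [J_t] need not converge; it obeys the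
    cocycle identity just as a limit would, since dropping an initial stretch of time does not
    change it. It is built from an uncountable supremum and may be discontinuous, so it enters
    Liouville's formula through successive pointwise limits of finite maxima of Lipschitz functions,
    dominated thanks to the uniform bound on [ln J_t].

    The flow is shown to be Lipschitz in [x] and no more, and the measure is known through the
    volumes of boxes; what the integration theory takes from them is translation invariance and
    finiteness on cubes. The error constants are uniform over a class of functions fixed by a bound,
    a Lipschitz constant and a support radius, because this is all that is known of the functions
    produced at intermediate times, and all of them up to a given time lie in one such class. *)

(** * Primitives and Gronwall's inequality on the line *)

Section OneVariable.
Variable R : realType.
Implicit Types (f df g P Q : R -> R) (a b t M : R).

Lemma is_derive_continuous f df :
  (forall t, is_derive t 1 f (df t)) -> continuous f.
Proof.
move=> fd t; apply: differentiable_continuous; apply/derivable1_diffP.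
by have [] := fd t.
Qed.

Lemma MVT_le f df a b M : a <= b -> (forall t, is_derive t 1 f (df t)) ->
  (forall t, a <= t <= b -> `|df t| <= M) -> `|f b - f a| <= M * (b - a).
Proof.
move=> ab fd bd.
have [|c cab ->] := MVT_segment ab (fun t _ => fd t).
  by apply: continuous_subspaceT; exact: is_derive_continuous fd.
rewrite normrM (ger0_norm (_ : 0 <= b - a)) ?subr_ge0// ler_wpM2r ?subr_ge0//.
by apply: bd; move: cab; rewrite in_itv.
Qed.

Lemma MVT_norm f df a b M : (forall t, is_derive t 1 f (df t)) ->
  (forall t, `|df t| <= M) -> `|f b - f a| <= M * `|b - a|.
Proof.
move=> fd bd; have [ab|/ltW ba] := leP a b.
  by rewrite [`|b - a|]ger0_norm ?subr_ge0//; exact: MVT_le fd _.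
by rewrite distrC [`|b - a|]distrC [`|a - b|]ger0_norm ?subr_ge0//; exact: MVT_le fd _.
Qed.

(** The integral over [[- n, x]] can be differentiated only for [x > - n]. Subtracting its value at
    [0] makes the result independent of [n], so these local primitives glue to one on the whole
    line. *)
Lemma exists_primitive f : continuous f ->
  exists P, P 0 = 0 /\ forall t, is_derive t 1 P (f t).
Proof.
move=> cf.
have int a b : lebesgue_measure.-integrable `[a, b]%classic (EFin \o f).
  apply: continuous_compact_integrable; first exact: segment_compact.
  exact: continuous_subspaceT.
pose I n x := (\int[@lebesgue_measure R]_(t in `[- n, x]) f t) -
   (\int[@lebesgue_measure R]_(t in `[- n, 0]) f t).
have dI (n x : R) : - n < x -> is_derive x 1 (I n) (f x).
  move=> nx.
  have [d1 d2] := @continuous_FTC1_closed R f (- n) x (x + 1) ltac:(by rewrite ltrDl)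
    (int _ _) nx (cf x).
  have -> : I n = (fun x => \int[lebesgue_measure]_(t in `[- n, x]) f t) -
     cst (\int[@lebesgue_measure R]_(t in `[- n, 0]) f t) by [].
  rewrite -[f x]subr0; apply: is_deriveB.
  by apply: DeriveDef => //; rewrite -derive1E.
have I0 (n : R) : I n 0 = 0 by rewrite /I subrr.
have II (n m x : R) : 0 < n -> n <= m -> - n < x -> I n x = I m x.
  move=> n0 nm nx.
  have dD (y : R) : - n < y -> is_derive y 1 (I n - I m) 0.
    move=> ny; rewrite -[0](subrr (f y)); apply: is_deriveB; apply: dI => //.
    by rewrite (le_lt_trans _ ny)// lerN2.
  have cD (y : R) : - n < y -> {for y, continuous (I n - I m)}.
    move=> ny; apply: differentiable_continuous; apply/derivable1_diffP.
    by have := dD y ny => -[].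
  have z0 : (I n - I m) 0 = 0 by rewrite !fctE !I0 subrr.
  apply/eqP; rewrite -subr_eq0; apply/eqP.
  have [x0|/ltW x0] := leP 0 x.
    have [c c0||c _] := @MVT_segment R (I n - I m) (cst 0) 0 x x0.
    - by apply: dD; move: c0; rewrite in_itv/= => /andP[c0 _]; lra.
    - apply: continuous_in_subspaceT => y; rewrite inE/= in_itv/= => /andP[y0 _].
      by apply: cD; lra.
    by rewrite z0 mul0r subr0.
  have [c c0||c _] := @MVT_segment R (I n - I m) (cst 0) x 0 x0.
  - by apply: dD; move: c0; rewrite in_itv/= => /andP[c0 _]; lra.
  - apply: continuous_in_subspaceT => y; rewrite inE/= in_itv/= => /andP[y0 _].
    by apply: cD; lra.
  by rewrite z0 mul0r sub0r => /eqP; rewrite oppr_eq0 => /eqP.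
(* The base point moves with [t], so before differentiating it is frozen at [|t| + 2], which
   dominates [|s| + 1] for all [s] within distance 1 of [t]. *)
exists (fun t => I (`|t| + 1) t); split=> [|t]; first exact: I0.
apply: (@near_eq_is_derive _ _ _ (I (`|t| + 2))); last first.
  by apply: dI; have := ler_norm (- t); rewrite normrN; lra.
near=> s.
have st : `|t - s| < 1.
  by near: s; apply: (@cvgr_dist_lt _ _ _ (nbhs t)) => //; exact: cvg_id.
have ss := ler_norm (- s); rewrite normrN in ss.
have := ler_distD t 0 s; rewrite !sub0r !normrN => h.
have s0 := normr_ge0 s.
rewrite (@II (`|s| + 1) (`|t| + 2))//; lra.
Unshelve. all: by end_near. Qed.

(** Choosing a primitive, rather than integrating over an interval, treats negative times without
    sign conventions. The default [cst 0] is not reached when [f] is continuous. *)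
Definition prim f : R -> R :=
  xget (cst 0) [set P | P 0 = 0 /\ forall t, is_derive t 1 P (f t)].

Lemma prim0 f : prim f 0 = 0.
Proof. by rewrite /prim; case: xgetP => // P _ []. Qed.

Lemma is_derive_prim f t : continuous f -> is_derive t 1 (prim f) (f t).
Proof.
move=> cf; rewrite /prim.
case: xgetP => [P _ [_]|noP]; first exact.
by have [P /noP] := exists_primitive cf.
Qed.

Lemma primE f Q t : (forall t, is_derive t 1 Q (f t)) -> continuous f ->
  prim f t = Q t - Q 0.
Proof.
move=> dQ cf.
have : (prim f - Q) t = (prim f - Q) 0.
  apply: is_derive_0_is_cst => x; rewrite -[0](subrr (f x)).
  by apply: is_deriveB; exact: is_derive_prim.
rewrite !fctE prim0; lra.
Qed.

Lemma prim_norm f a M : continuous f -> (forall t, `|f t| <= M) ->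
  `|prim f a| <= M * `|a|.
Proof.
move=> cf fM; rewrite -[prim f a]subr0 -(prim0 f) -[in leRHS](subr0 a).
exact: MVT_norm (fun t => is_derive_prim t cf) fM.
Qed.

Lemma primB_le f g a M : 0 <= a -> continuous f -> continuous g ->
  (forall t, 0 <= t <= a -> `|f t - g t| <= M) ->
  `|prim f a - prim g a| <= M * a.
Proof.
move=> a0 cf cg h; have := @MVT_le (prim f - prim g) (f - g) 0 a M a0.
rewrite !fctE !prim0 !subr0; apply=> [t|t /h//].
by apply: is_deriveB; exact: is_derive_prim.
Qed.

Lemma primB_norm f g a M : continuous f -> continuous g ->
  (forall t, `|f t - g t| <= M) ->
  `|prim f a - prim g a| <= M * `|a|.
Proof.
move=> cf cg h; have := @MVT_norm (prim f - prim g) (f - g) 0 a M.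
rewrite !fctE !prim0 !subr0; apply=> // t.
by apply: is_deriveB; exact: is_derive_prim.
Qed.

(** Link between [prim] and the time integrals in the statement of the theorem. *)
Lemma Rintegral_prim f t : continuous f -> 0 <= t ->
  Rintegral lebesgue_measure `[0, t]%classic f = prim f t.
Proof.
move=> cf; rewrite le_eqVlt => /predU1P[<-|t0].
  by rewrite prim0 set_itv1 Rintegral_set1.
have cP := is_derive_continuous (fun t => is_derive_prim t cf).
rewrite /Rintegral (@continuous_FTC2 _ f (prim f) 0 t t0) ?prim0 ?sube0//.
- exact: continuous_subspaceT.
- split.
  + by move=> x _; have [] := is_derive_prim x cf.
  + exact: cvg_at_right_filter (cP 0).
  + exact: cvg_at_left_filter (cP t).
- by move=> x _; rewrite derive1E; have [] := is_derive_prim x cf.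
Qed.

(** Two-sided in time, since the flow is also run backwards: [expR (- k * s) * E s] is
    nonincreasing, which settles [t >= 0], and [expR (k * s) * E s] is nondecreasing, which settles
    [t <= 0]. *)
Lemma gronwall (E E' : R -> R) (k t : R) : (forall s : R, is_derive s 1 E (E' s)) ->
  (forall s, `|E' s| <= k * E s) -> E t <= expR (k * `|t|) * E 0.
Proof.
move=> dE bE.
have aux (e : R) : (forall s : R, is_derive s 1 (fun s => expR (e * s) * E s)
    (e * expR (e * s) * E s + expR (e * s) * E' s)).
  move=> s.
  have h1 : is_derive s 1 (fun s => e * s) (e * 1).
    have h := is_deriveM (is_derive_cst e s 1) (is_derive_id s (1 : R)).
    by apply: (is_derive_eq h); rewrite scaler0 addr0.
  have h2 : is_derive s 1 (expR \o (fun s => e * s)) (expR (e * s) * (e * 1)).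
    exact: is_derive1_comp.
  apply: (is_derive_eq (is_deriveM h2 (dE s))).
  by rewrite /= /GRing.scale/=; ring.
have cE e := is_derive_continuous (aux e).
have [t0|/ltW t0] := leP 0 t.
  have [c _] := MVT_segment t0 (fun s _ => aux (- k) s) (continuous_subspaceT (cE _)).
  rewrite mulr0 expR0 mul1r mulNr expRN => hc.
  have h : (expR (k * t))^-1 * E t <= E 0.
    rewrite -subr_le0 hc subr0 mulr_le0_ge0//.
    rewrite (_ : _ + _ = expR (- k * c) * (E' c - k * E c)); last by ring.
    rewrite mulr_ge0_le0 ?expR_ge0//.
    by have := ler_norm (E' c); have := bE c; lra.
  by rewrite (ger0_norm t0) -ler_pdivrMl ?expR_gt0.
have [c _] := MVT_segment t0 (fun s _ => aux k s) (continuous_subspaceT (cE _)).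
rewrite mulr0 expR0 mul1r => hc.
have h : expR (k * t) * E t <= E 0.
  rewrite -subr_ge0 hc mulr_ge0 ?subr_ge0//.
  rewrite (_ : _ + _ = expR (k * c) * (E' c + k * E c)); last by ring.
  rewrite mulr_ge0 ?expR_ge0//.
  by have := ler_norm (- E' c); rewrite normrN; have := bE c; lra.
by rewrite (ler0_norm t0) mulrN expRN -ler_pdivrMl ?invr_gt0 ?expR_gt0// invrK.
Qed.

End OneVariable.

(** * Bounded Lipschitz and periodic functions of several variables *)

Section SeveralVariables.
Variables (R : realType) (d : nat).
Local Notation E := 'rV[R]_d.
Implicit Types (f g : E -> R) (x y z : E) (M N L : R) (i j : 'I_d).

Lemma coord_le_norm x i : `|x ord0 i| <= `|x|.
Proof.
rewrite [leRHS]/Num.Def.normr /= mx_normrE.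
exact: (le_bigmax _ (fun k : 'I_1 * 'I_d => `|x k.1 k.2|) (ord0, i)).
Qed.

Lemma norm_le_coord x M : 0 <= M -> (forall i, `|x ord0 i| <= M) -> `|x| <= M.
Proof.
move=> M0 h; rewrite [leLHS]/Num.Def.normr /= mx_normrE.
by apply/bigmax_leP; split=> // -[a b] _ /=; rewrite ord1.
Qed.

Lemma evecE i j : evec R i ord0 j = (j == i)%:R.
Proof. by rewrite /evec mxE eqxx. Qed.

Lemma norm_evec i : `|evec R i| <= 1.
Proof.
by apply: norm_le_coord => // j; rewrite evecE; case: eqP; rewrite ?normr1 ?normr0.
Qed.

Lemma is_derive_cvg (V W : normedModType R) (f : V -> W) a v l :
  (fun h => h^-1 *: ((f \o shift a) (h *: v) - f a)) @ 0^' --> l ->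
  is_derive a v f l.
Proof.
by move=> h; apply: DeriveDef; [apply/cvg_ex; exists l|exact/cvg_lim].
Qed.

Lemma is_derive_line f x v (s l : R) :
  is_derive s 1 (fun s : R => f (x + s *: v)) l <-> is_derive (x + s *: v) v f l.
Proof.
have eqq : (fun h : R => h^-1 *: (((fun s : R => f (x + s *: v)) \o shift s) (h *: (1 : R))
    - f (x + s *: v))) =
  (fun h : R => h^-1 *: ((f \o shift (x + s *: v)) (h *: v) - f (x + s *: v))).
  apply/funext => h /=; congr (_ *: (f _ - _)).
  by rewrite /shift/= scalerDl addrCA [h *: 1]mulr1.
by split => -[h1 <-]; apply: is_derive_cvg; [rewrite -eqq|rewrite eqq]; exact: h1.
Qed.

Lemma exists_mean_value (g dg : R -> R) (b : R) :
  (forall s : R, is_derive s 1 g (dg s)) ->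
  exists s, `|s| <= `|b| /\ g b - g 0 = dg s * b.
Proof.
move=> dgP; have cg := is_derive_continuous dgP.
have [b0|/ltW b0] := leP 0 b.
  have [c + ->] := MVT_segment b0 (fun s _ => dgP s) (continuous_subspaceT cg).
  rewrite in_itv/= => /andP[c0 cb]; exists c.
  by rewrite subr0 !ger0_norm.
have [c + h] := MVT_segment b0 (fun s _ => dgP s) (continuous_subspaceT cg).
rewrite in_itv/= => /andP[c0 cb]; exists c; split; first by rewrite !ler0_norm// lerN2.
by rewrite -opprB h sub0r mulrN opprK.
Qed.

(** Only partial derivatives are available, so [x] is moved to [y] one coordinate at a time: [zz k]
    has the first [k] coordinates of [y] and the others of [x]. In the sup norm all intermediate
    points stay within [|y - x|] of [x]. *)
Lemma multi_mean_value f x y :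
  (forall i z, derivable f z (evec R i)) ->
  exists xi : 'I_d -> E, (forall k, `|xi k - x| <= `|y - x|) /\
    f y - f x = \sum_(k < d) partial k f (xi k) * (y ord0 k - x ord0 k).
Proof.
move=> df; pose zz (k : nat) : E := \row_i (if (i < k)%N then y ord0 i else x ord0 i).
have zzS (k : 'I_d) : zz k.+1 = zz k + (y ord0 k - x ord0 k) *: evec R k.
  apply/rowP => i; rewrite !mxE/=.
  have [ik|ki|/val_inj ->] := ltngtP i k.
  - rewrite ltnS (ltnW ik) (_ : (i == k) = false) ?mulr0 ?addr0//.
    by apply/eqP => ik'; rewrite ik' ltnn in ik.
  - rewrite ltnS leqNgt ki/= (_ : (i == k) = false) ?mulr0 ?addr0//.
    by apply/eqP => ik'; rewrite ik' ltnn in ki.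
  - by rewrite ltnS leqnn eqxx mulr1 addrC subrK.
have step (k : 'I_d) : exists p, `|p - x| <= `|y - x| /\
    f (zz k.+1) - f (zz k) = partial k f p * (y ord0 k - x ord0 k).
  have dl (s : R) : is_derive s 1 (fun s => f (zz k + s *: evec R k))
      (partial k f (zz k + s *: evec R k)).
    by apply/is_derive_line; apply: DeriveDef => //; exact: df.
  have [s [sb]] := exists_mean_value (y ord0 k - x ord0 k) dl.
  rewrite -zzS scale0r addr0 => h; exists (zz k + s *: evec R k); split=> //.
  apply: norm_le_coord => // i; rewrite !mxE/=.
  have [ik|ki|/val_inj ->] := ltngtP i k.
  - rewrite (_ : (i == k) = false) ?mulr0 ?addr0; last first.
      by apply/eqP => ik'; rewrite ik' ltnn in ik.
    by rewrite (le_trans _ (coord_le_norm (y - x) i))// !mxE.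
  - rewrite (_ : (i == k) = false) ?mulr0 ?addr0 ?subrr ?normr0//.
    by apply/eqP => ik'; rewrite ik' ltnn in ki.
  - rewrite eqxx mulr1 addrAC subrr add0r (le_trans sb)//.
    by rewrite (le_trans _ (coord_le_norm (y - x) k))// !mxE.
have [xi hxi] := choice step.
exists xi; split=> [k|]; first by have [] := hxi k.
under eq_bigr do rewrite -(proj2 (hxi _)).
have -> : y = zz d by apply/rowP => i; rewrite mxE ltn_ord.
have -> : x = zz 0 by apply/rowP => i; rewrite mxE.
rewrite -(big_mkord predT (fun k => f (zz k.+1) - f (zz k))).
by rewrite telescope_sumr.
Qed.

Lemma lipschitz_of_partials f M :
  (forall i z, derivable f z (evec R i)) ->
  (forall i z, `|partial i f z| <= M) ->
  forall x y, `|f x - f y| <= d%:R * M * `|x - y|.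
Proof.
move=> df bf x y; have [xi [_ ->]] := multi_mean_value y x df.
apply: (le_trans (ler_norm_sum _ _ _)).
have -> : d%:R * M * `|x - y| = \sum_(k < d) M * `|x - y|.
  by rewrite sumr_const card_ord mulr_natl mulrnAl.
apply: ler_sum => k _; rewrite normrM ler_pM//.
by have := coord_le_norm (x - y) k; rewrite !mxE.
Qed.

(** Chain rule obtained from continuity of the partial derivatives: the points [xi h k] given by the
    mean value theorem tend to [c t]. *)
Lemma is_derive_curve f (c : R -> E) (t : R) (v : E) :
  Ck 1 f -> is_derive t 1 c v ->
  is_derive t 1 (f \o c) (dotv (grad f (c t)) v).
Proof.
move=> [_ cf] [dc dcv]; apply: is_derive_cvg => /=.
have df i z : derivable f z (evec R i) by have [] := cf i.
have [xi hxi] := choice (fun h : R => multi_mean_value (c t) (c (h *: (1:R) + t)) df).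
rewrite (_ : (fun h => _) = (fun h => \sum_(k < d) partial k f (xi h k) *
    (h^-1 * (c (h *: (1:R) + t) ord0 k - c t ord0 k)))); last first.
  apply/funext => h; have [_ ->] := hxi h.
  by rewrite /GRing.scale/= mulr_sumr; apply: eq_bigr => k _; rewrite mulrCA.
have cc : c (h *: (1:R) + t) @[h --> 0^'] --> c t.
  have ct : {for t, continuous c}.
    by apply: differentiable_continuous; apply/derivable1_diffP.
  have ht : (h *: (1:R) + t) @[h --> 0^'] --> t.
    rewrite -[X in _ --> X]add0r; apply: cvgD; last exact: cvg_cst.
    rewrite (_ : (fun h : R => h *: (1:R)) = id); first exact: cvg_within.
    by apply/funext => h; rewrite [h *: 1]mulr1.
  exact: (cvg_comp _ _ ht ct).
rewrite /dotv; apply: cvg_big => [|k _]; [exact: add_continuous|apply: cvgM].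
  rewrite /grad mxE.
  have [_ + ] := cf k; move=> /(_ (c t)) pk.
  have xik : xi h k @[h --> 0^'] --> c t.
    apply/cvgrPdist_le => e e0.
    move/cvgrPdist_le : cc => /(_ _ e0); apply: filterS => h hh.
    rewrite distrC; have [+ _] := hxi h; move=> /(_ k) /le_trans -> //.
    by rewrite distrC.
  exact: (cvg_comp _ _ xik pk).
have dk : derivable (fun s => c s ord0 k) t 1 by move/derivable_mxP : dc.
rewrite -dcv derive_mx// mxE.
exact: dk.
Qed.

(** A single constant serves as bound and as Lipschitz constant, so that one number describes a
    class of functions over which estimates can be uniform. *)
Definition blip M f := (forall x, `|f x| <= M) /\
  (forall x y, `|f x - f y| <= M * `|x - y|).

Lemma blip_ge0 M f : blip M f -> 0 <= M.
Proof. by move=> [h _]; exact: le_trans (h 0). Qed.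

Lemma blip_le M N f : M <= N -> blip M f -> blip N f.
Proof.
move=> MN [h1 h2]; split=> [x|x y]; first exact: le_trans (h1 x) MN.
by rewrite (le_trans (h2 x y))// ler_wpM2r.
Qed.

Lemma blipD M N f g : blip M f -> blip N g -> blip (M + N) (fun x => f x + g x).
Proof.
move=> [f1 f2] [g1 g2]; split=> [x|x y].
  by rewrite (le_trans (ler_normD _ _))// lerD.
by rewrite opprD addrACA (le_trans (ler_normD _ _))// mulrDl lerD.
Qed.

Lemma blipM M N f g : blip M f -> blip N g ->
  blip (2 * (M * N)) (fun x => f x * g x).
Proof.
move=> bf bg; have M0 := blip_ge0 bf; have N0 := blip_ge0 bg.
have MN0 := mulr_ge0 M0 N0.
move: bf bg => [f1 f2] [g1 g2]; split=> [x|x y].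
  have : `|f x * g x| <= M * N by rewrite normrM ler_pM.
  lra.
rewrite (_ : _ - _ = f x * (g x - g y) + (f x - f y) * g y); last by ring.
rewrite (le_trans (ler_normD _ _))// !normrM.
have h1 : `|f x| * `|g x - g y| <= M * (N * `|x - y|) by rewrite ler_pM.
have h2 : `|f x - f y| * `|g y| <= (M * `|x - y|) * N by rewrite ler_pM.
lra.
Qed.

Lemma blip_comp M L f (T : E -> E) : 0 <= L ->
  (forall x y, `|T x - T y| <= L * `|x - y|) -> blip M f ->
  blip (M * (1 + L)) (f \o T).
Proof.
move=> L0 hT bf; have M0 := blip_ge0 bf; move: bf => [f1 f2]; split=> [x|x y] /=.
  by rewrite (le_trans (f1 _))// mulrDr mulr1 lerDl mulr_ge0.
rewrite (le_trans (f2 _ _))// -mulrA ler_wpM2l// (le_trans (hT _ _))//.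
by rewrite ler_wpM2r// lerDr.
Qed.

Lemma blip_max M f g : blip M f -> blip M g -> blip M (fun x => Num.max (f x) (g x)).
Proof.
move=> [f1 f2] [g1 g2]; split=> [x|x y].
  by case: (leP (f x) (g x)).
have := f2 x y; have := g2 x y; rewrite !ler_norml => /andP[? ?] /andP[? ?].
by case: (leP (f x) (g x)) => ?; case: (leP (f y) (g y)) => ?; lra.
Qed.

Lemma expR_lip (a b M : R) : `|a| <= M -> `|b| <= M ->
  `|expR a - expR b| <= expR M * `|a - b|.
Proof.
wlog ab : a b / b <= a => [H aM bM|].
  have [/H|/ltW /H] := leP b a; first exact.
  by rewrite distrC [`|a - b|]distrC; exact.
move=> /ler_normlP[_ aM] /ler_normlP[bM _].
rewrite [`|a - b|]ger0_norm ?subr_ge0//.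
apply: (@MVT_le R expR expR b a (expR M) ab (fun t => is_derive_expR t)) => t /andP[_ ta].
by rewrite ger0_norm ?expR_ge0// ler_expR (le_trans ta).
Qed.

Lemma blip_expR M f : blip M f -> blip (expR M * (1 + M)) (fun x => expR (f x)).
Proof.
move=> bf; have M0 := blip_ge0 bf; move: bf => [f1 f2]; split=> [x|x y].
  rewrite ger0_norm ?expR_ge0// (@le_trans _ _ (expR M))//.
    by rewrite ler_expR (le_trans (ler_norm _)).
  by rewrite ler_peMr ?expR_ge0// lerDl.
rewrite (le_trans (expR_lip (f1 x) (f1 y)))// -mulrA ler_wpM2l ?expR_ge0//.
by rewrite (le_trans (f2 x y))// ler_wpM2r// lerDr.
Qed.

Lemma blip_continuous M f : blip M f -> continuous f.
Proof.
move=> bf; have M0 := blip_ge0 bf; move: bf => [_ f2] x.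
have FF : Filter (nbhs x) by exact: nbhs_filter.
apply/cvgrPdist_le => e e0.
suff : nbhs (x : E) [set y | `|f x - f y| <= e] by [].
apply/(@nbhs_ballP _ E).
exists (e / (M + 1)) => [|y]; first by rewrite /= divr_gt0// ltr_wpDl.
rewrite -ball_normE/= => /ltW h; rewrite (le_trans (f2 x y))//.
rewrite (le_trans (ler_wpM2l M0 h))// mulrA ler_pdivrMr ?ltr_wpDl//.
by rewrite mulrC ler_wpM2l ?lerDl ?ltW.
Qed.

Lemma Yperiodic_int (V : Type) (f : E -> V) (n : int) i x : Yperiodic f ->
  f (x + n%:~R *: evec R i) = f x.
Proof.
move=> pf; have nat_case m y : f (y + m%:R *: evec R i) = f y.
  elim: m y => [|m IH] y; first by rewrite scale0r addr0.
  by rewrite -natr1 scalerDl scale1r addrA pf IH.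
case: n => m; first exact: nat_case.
rewrite NegzE mulrNz scaleNr -[LHS](nat_case m.+1).
by rewrite -addrA [X in _ + X]addrC subrr addr0.
Qed.

Lemma exists_translate_in_cube x : exists y, `|y| <= 1 /\
  forall (V : Type) (f : E -> V), Yperiodic f -> f x = f y.
Proof.
pose n i := Num.floor (x ord0 i).
exists (\row_i (x ord0 i - (n i)%:~R)); split.
  apply: norm_le_coord => // i; rewrite mxE.
  have h1 := ge_floor (x ord0 i); have h2 := lt_succ_floor (x ord0 i).
  by rewrite ger0_norm ?subr_ge0// lerBlDl ltW//; move: h2; rewrite intrD1.
move=> V f pf.
pose z (s : seq 'I_d) : E := x + \sum_(i <- s) (- n i)%:~R *: evec R i.
have fz s : f (z s) = f x.
  rewrite /z; elim: s => [|i s IH]; first by rewrite big_nil addr0.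
  by rewrite big_cons addrCA addrC Yperiodic_int.
rewrite -(fz (index_enum 'I_d)); congr f; apply/rowP => j.
rewrite !mxE summxE (bigD1 j)//= big1 ?addr0; last first.
  by move=> i ij; rewrite mxE evecE eq_sym (negbTE ij) mulr0.
by rewrite mxE evecE eqxx mulr1 mulrNz.
Qed.

Lemma Yperiodic_bounded f : continuous f -> Yperiodic f ->
  exists2 M, 0 <= M & forall x, `|f x| <= M.
Proof.
move=> cf pf.
have K : compact [set x : E | `|x| <= 1].
  apply: bounded_closed_compact.
    by exists 1; split=> // M M1 x /= /le_trans; apply; exact: ltW.
  apply: (@closed_comp _ _ (fun x : E => `|x|) [set t : R | t <= 1]).
    by move=> x _; exact: norm_continuous.
  exact: closed_le.
have K0 : [set x : E | `|x| <= 1] !=set0 by exists 0 => /=; rewrite normr0.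
have [|c _ hc] := @EVT_max_rV R d (fun x => `|f x|) _ K0 K.
  apply: continuous_subspaceT => x; apply: continuous_comp; first exact: cf.
  exact: norm_continuous.
exists `|f c| => // x; have [y [y1 /(_ _ f pf) ->]] := exists_translate_in_cube x.
by apply: hc; rewrite inE.
Qed.

Lemma Yperiodic_partial i f : Yperiodic f -> Yperiodic (partial i f).
Proof.
move=> pf j x; rewrite /partial /derive.
congr (lim (_ @ 0^')); apply/funext => h /=.
by rewrite /shift/= addrA !pf.
Qed.

(** Common core of the periodic and the compactly supported cases, which differ only in how the
    bounds on [f] and its partial derivatives are found. *)
Lemma Ck1_bounded_blip f M : 0 <= M -> (forall x, `|f x| <= M) ->
  (forall i, (forall x, derivable f x (evec R i)) /\ Ck 0 (partial i f)) ->
  (forall i, exists2 Mi, 0 <= Mi & forall x, `|partial i f x| <= Mi) ->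
  exists2 N, 0 <= N & blip N f.
Proof.
move=> M0 fM df h.
have h' i : exists Mi, 0 <= Mi /\ forall x, `|partial i f x| <= Mi.
  by have [Mi] := h i; exists Mi.
have [N hN] := choice h'.
have N0 : 0 <= \sum_i N i by apply: sumr_ge0 => i _; have [] := hN i.
have NN : 0 <= d%:R * \sum_i N i by rewrite mulr_ge0.
exists (M + d%:R * \sum_i N i); first by rewrite addr_ge0.
split=> [x|x y]; first by rewrite (le_trans (fM x))// lerDl.
rewrite (le_trans (@lipschitz_of_partials f (\sum_i N i) _ _ x y))//.
- by move=> i z; have [+ _] := df i; exact.
- move=> i z; have [_ hi] := hN i; rewrite (le_trans (hi z))//.
  rewrite (bigD1 i)//= lerDl sumr_ge0// => k _; by have [] := hN k.
by rewrite ler_wpM2r// lerDr.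
Qed.

Lemma Yperiodic_Ck1_blip f : Ck 1 f -> Yperiodic f -> exists2 M, 0 <= M & blip M f.
Proof.
move=> [cf df] pf; have [M M0 fM] := Yperiodic_bounded cf pf.
apply: (Ck1_bounded_blip M0 fM df) => i; have [_ ci] := df i.
exact: Yperiodic_bounded ci (@Yperiodic_partial i f pf).
Qed.


End SeveralVariables.

(** * Integration of compactly supported functions *)

Section Measurability.
Variables (R : realType) (d : nat).
Local Notation E := 'rV[R]_d.
Local Notation T := (Rd_meas R d).

Lemma measurable_box (a b : E) : measurable (box a b : set T).
Proof. by apply: sub_sigma_algebra; exists a, b. Qed.

(** An open set is the union of the grid boxes contained in it, over all meshes [1 / n.+1]; the
    pairs of a mesh and an integer corner are countable. *)
Lemma open_measurable_Rd (U : set E) : open U -> measurable (U : set T).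
Proof.
move=> oU.
pose F (q : nat * 'rV[int]_d) : set T :=
  let B := box (\row_i ((q.2 ord0 i - 1)%:~R / q.1.+1%:R))
    (\row_i ((q.2 ord0 i)%:~R / q.1.+1%:R)) : set E in
  if `[< B `<=` U >] then B else set0.
have -> : U = \bigcup_q F q.
  apply/seteqP; split=> [x Ux|x [q _]]; last by rewrite /F; case: asboolP => // sub /sub.
  have /nbhs_ballP[e /= e0 be] : nbhs x U by rewrite openE in oU; exact: oU.
  pose n := Num.truncn e^-1.
  have n0 : 0 < n.+1%:R :> R by rewrite ltr0n.
  have ne : n.+1%:R^-1 < e by rewrite -[ltRHS]invrK ltf_pV2 ?posrE ?invr_gt0// truncnS_gt.
  (* Boxes are open below and closed above, so the box containing [x] has its upper corner at the
     ceiling. *)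
  exists (n, \row_i Num.ceil (x ord0 i * n.+1%:R)) => //.
  have hB : box (\row_i (((\row_i Num.ceil (x ord0 i * n.+1%:R)) ord0 i - 1)%:~R / n.+1%:R))
     (\row_i (((\row_i Num.ceil (x ord0 i * n.+1%:R)) ord0 i)%:~R / n.+1%:R)) x.
    move=> i; rewrite /Defs.coord !mxE ltr_pdivrMr// ler_pdivlMr//.
    by have /andP[-> ->] := ceil_itv (x ord0 i * n.+1%:R).
  rewrite /F/=; case: asboolP => // -[] y hy; apply: be; rewrite -ball_normE/=.
  apply: le_lt_trans ne; apply: norm_le_coord => [|i]; first by rewrite invr_ge0 ltW.
  have := hB i; have := hy i; rewrite /Defs.coord !mxE.
  set c := Num.ceil _; rewrite intrD mulrDl (_ : (-1)%:~R = -1) ?rmorphN//.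
  rewrite mulN1r; set p := c%:~R / _; set q := _^-1; clearbody p q.
  by move=> /andP[h1 h2] /andP[h3 h4]; rewrite ler_norml; apply/andP; split; lra.
apply: (@countable_bigcupT_measurable _ T _ F) => [|q]; first exact: countableP.
by rewrite /F; case: asboolP => _; [exact: measurable_box|exact: measurable0].
Qed.

Lemma continuous_measurable_Rd (f : E -> R) : continuous f ->
  measurable_fun [set: T] (f : T -> R).
Proof.
move=> /continuousP cf; apply: (measurability _ (RGenOpens.measurableE R)).
move=> _ [_ [a [b ->]] <-]; rewrite setTI; apply: open_measurable_Rd.
by apply: cf; exact: interval_open.
Qed.

Lemma measurable_translation (v : E) :
  measurable_fun [set: T] ((fun x => x + v) : T -> T).
Proof.
apply: (@measurability _ _ T T setT _ (@boxes R d)) => //.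
move=> _ [_ [a [b ->]] <-]; rewrite setTI.
rewrite (_ : _ @^-1` _ = box (a - v) (b - v)); first exact: measurable_box.
apply/seteqP; split=> x h i; have := h i; rewrite /Defs.coord !mxE.
  by rewrite ltrBlDr lerBrDr.
by rewrite ltrBlDr lerBrDr.
Qed.

End Measurability.

(** * Lebesgue measure and the integral of bounded functions supported in a ball *)

Section Integral.
Variables (R : realType) (d : nat).
Local Notation E := 'rV[R]_d.
Local Notation T := (Rd_meas R d).
Variable (mu : {measure set T -> \bar R}).
Hypothesis Hmu : is_lebesgue_Rd mu.
Implicit Types (f g : E -> R) (M r : R).

(** The margin 1 compensates for the open lower faces of a box; [|r|] keeps the faces in order when
    [r] is negative. *)
Definition cube r : set E := box (\row_(i < d) (- (`|r| + 1))) (\row_(i < d) (`|r| + 1)).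

Lemma cubeP r x : `|x| <= r -> cube r x.
Proof.
move=> xr i; rewrite /Defs.coord !mxE.
have := le_trans (coord_le_norm x i) xr; have := ler_norm r.
rewrite ler_norml => h /andP[? ?]; apply/andP; split; lra.
Qed.

Lemma setI_closed_boxes : setI_closed (@boxes R d).
Proof.
move=> _ _ [a [b ->]] [a' [b' ->]].
exists (\row_i Num.max (a ord0 i) (a' ord0 i)), (\row_i Num.min (b ord0 i) (b' ord0 i)).
apply/seteqP; split=> [x [h1 h2] i|x h].
  have := h1 i; have := h2 i; rewrite /Defs.coord !mxE gt_max le_min.
  by move=> /andP[p1 p2] /andP[p3 p4]; rewrite p1 p2 p3 p4.
by split=> i; have := h i; rewrite /Defs.coord !mxE gt_max le_min =>
  /andP[/andP[p1 p2] /andP[p3 p4]]; rewrite ?p1 ?p2 ?p3 ?p4.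
Qed.

Lemma cover_cube : \bigcup_n cube n%:R = [set: E].
Proof.
apply/seteqP; split=> // x _; exists (Num.truncn `|x|).+1 => //.
by apply: cubeP; rewrite ltW// truncnS_gt.
Qed.

(* Unqualified, [coord] would be the coordinate function of [vector]. *)
Lemma box_volume (a b : E) : mu (box a b : set T) =
  (\prod_(i < d) Num.max 0 (Defs.coord b i - Defs.coord a i))%:E.
Proof.
have [h|/existsNP[i /negP]] := pselect (forall i, Defs.coord a i <= Defs.coord b i).
  rewrite Hmu//; congr (_%:E); apply: eq_bigr => i _.
  by rewrite max_r// subr_ge0.
rewrite -ltNge => ba.
rewrite (_ : box a b = set0) ?measure0.
  by rewrite (bigD1 i)//= max_l ?mul0r// subr_le0 ltW.
by apply/seteqP; split=> // x /(_ i) /andP[h1 h2]; have := lt_le_trans h1 h2; lra.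
Qed.

Lemma cube_fin r : (mu (cube r : set T) < +oo)%E.
Proof. by rewrite box_volume ltry. Qed.

(** [mu] and its image under the translation agree on boxes. These form a pi-system generating the
    sigma-algebra, and cubes of finite measure exhaust the space, so uniqueness of measures
    applies. *)
Lemma translation_invariant (v : E) (A : set T) : measurable A ->
  mu ((fun x : T => (x + v : E) : T) @^-1` A) = mu A.
Proof.
move=> mA; have mt := @measurable_translation R d v.
pose m1 : {measure set T -> \bar R} :=
  measure_function_pushforward__canonical__measure_function_Measure mu mt.
apply: (@measure_unique _ R T (@boxes R d) (fun n => cube n%:R) erefl
  setI_closed_boxes _ _ m1 mu _ _ A mA).
- by move=> n; eexists; eexists.
- exact: cover_cube.
- move=> _ [a [b ->]]; rewrite /m1 /= /pushforward.
  rewrite (_ : _ @^-1` _ = box (a - v) (b - v)).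
    rewrite !box_volume; congr (_%:E); apply: eq_bigr => i _; congr Num.max.
    rewrite /Defs.coord !mxE; ring.
  by apply/seteqP; split=> x h i; have := h i; rewrite /Defs.coord !mxE ltrBlDr lerBrDr.
- move=> n; rewrite /m1 /= /pushforward.
  rewrite (_ : _ @^-1` _ = box ((\row_(i < d) (- (`|n%:R| + 1))) - v)
    ((\row_(i < d) (`|n%:R| + 1)) - v)).
    by rewrite box_volume ltry.
  by apply/seteqP; split=> x h i; have := h i; rewrite /Defs.coord !mxE ltrBlDr lerBrDr.
Qed.

(** Exactly the data that yield the integrable majorant [M * \1_(cube r)]. *)
Definition mbs M r f := [/\ measurable_fun [set: T] (f : T -> R),
  forall x, `|f x| <= M & forall x, r < `|x| -> f x = 0].

Definition Rd_integral f : R := Rintegral mu [set: T] (f : T -> R).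

Definition vol r : R := fine (mu (cube r : set T)).

Lemma vol_ge0 r : 0 <= vol r.
Proof. by rewrite fine_ge0. Qed.

Lemma mbs_ge0 M r f : mbs M r f -> 0 <= M.
Proof. by case=> _ h _; exact: le_trans (h 0). Qed.

Lemma mbs_le_indic M r f x : mbs M r f -> `|f x| <= M * \1_(cube r) x.
Proof.
move=> fM; have M0 := mbs_ge0 fM; case: fM => _ fM f0.
have [xr|xr] := leP `|x| r; first by rewrite indicE mem_set ?mulr1//; exact: cubeP.
by rewrite f0// normr0 mulr_ge0.
Qed.

Lemma integrable_indic_cube r :
  mu.-integrable [set: T] (EFin \o (\1_(cube r) : T -> R)).
Proof.
have mc : measurable (cube r : set T) by exact: measurable_box.
apply/integrableP; split; first by apply/measurable_EFinP; exact: measurable_indic.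
rewrite (eq_integral (fun x => (\1_(cube r : set T) x)%:E)); last first.
  by move=> x _ /=; rewrite ger0_norm.
by rewrite integral_indic// setIT; exact: cube_fin.
Qed.

Lemma integrable_cube M r :
  mu.-integrable [set: T] (fun x : T => (M * \1_(cube r) x)%:E).
Proof. exact: (integrableZl measurableT M (integrable_indic_cube r)). Qed.

Lemma mbs_integrable M r f : mbs M r f ->
  mu.-integrable [set: T] (EFin \o (f : T -> R)).
Proof.
move=> fM; have M0 := mbs_ge0 fM.
apply: (le_integrable measurableT _ _ (integrable_cube M r)).
  by apply/measurable_EFinP; case: fM.
move=> x _ /=; rewrite lee_fin [leRHS]ger0_norm ?mulr_ge0//.
exact: mbs_le_indic.
Qed.

Lemma Rd_integral_norm M r f : mbs M r f -> `|Rd_integral f| <= M * vol r.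
Proof.
move=> fM; have fi := mbs_integrable fM.
rewrite (le_trans (le_normr_Rintegral _ fi))//.
have -> : M * vol r = Rintegral mu [set: T] (fun x : T => M * \1_(cube r) x).
  rewrite RintegralZl//; last exact: integrable_indic_cube.
  rewrite /vol /Rintegral integral_indic ?setIT//; exact: measurable_box.
apply: le_Rintegral => //; last by move=> x _; exact: mbs_le_indic.
- exact: (integrable_norm fi).
- exact: integrable_cube.
Qed.

Lemma mbs_le M N r s f : M <= N -> r <= s -> mbs M r f -> mbs N s f.
Proof.
move=> MN rs [mf bf f0]; split=> // x; first exact: le_trans (bf x) MN.
by move=> sx; apply: f0; exact: le_lt_trans sx.
Qed.

Lemma Rd_integral_sub M N r s f g : mbs M r f -> mbs N s g ->
  Rd_integral (fun x => f x - g x) = Rd_integral f - Rd_integral g.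
Proof.
move=> fM gN; apply: RintegralB => //; first exact: mbs_integrable fM.
exact: mbs_integrable gN.
Qed.

Lemma Rd_integral_dist M N C r f g : mbs M r f -> mbs N r g ->
  (forall x, `|f x - g x| <= C) -> `|Rd_integral f - Rd_integral g| <= C * vol r.
Proof.
move=> fM gN fg; rewrite -(Rd_integral_sub fM gN); apply: Rd_integral_norm; split=> //.
- by case: fM => mf _ _; case: gN => mg _ _; exact: measurable_funB.
- by move=> x rx; case: fM => _ _ ->//; case: gN => _ _ ->//; rewrite subrr.
Qed.

(** Dominated convergence; the majorant depends on [M] and [r] alone and hence serves the whole
    sequence. *)
Lemma Rd_integral_cvg M r (F : nat -> E -> R) f : (forall n, mbs M r (F n)) ->
  (forall x, F n x @[n --> \oo] --> f x) -> Rd_integral (F n) @[n --> \oo] --> Rd_integral f.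
Proof.
move=> FM Ff.
have mf : mbs M r f.
  split=> [|x|x rx].
  - by apply: (@measurable_fun_cvg _ T R setT F) => // n; case: (FM n).
  - have h : `|F n x| @[n --> \oo] --> `|f x| by apply: cvg_norm; exact: Ff.
    rewrite -(cvg_lim (@Rhausdorff R) h).
    apply: limr_le; first by apply/cvg_ex; exists `|f x|.
    by apply: nearW => n; case: (FM n).
  - have := Ff x; rewrite (_ : F ^~ x = cst 0); last first.
      by apply/funext => n; case: (FM n) => _ _ ->.
    by move=> /(cvg_lim (@Rhausdorff R)) <-; exact: lim_cst.
have := @dominated_cvg _ _ R mu [set: T] measurableT
  (fun n => EFin \o (F n : T -> R)) (EFin \o (f : T -> R))
  (fun x => (M * \1_(cube r) x)%:E) _ _ _ (integrable_cube M r) _.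
have -> : (\int[mu]_x (EFin \o (f : T -> R)) x = (Rd_integral f)%:E)%E.
  by rewrite fineK//; apply: integrable_fin_num => //; exact: mbs_integrable mf.
move=> h; apply: fine_cvg; apply: h.
- by move=> n; apply/measurable_EFinP; case: (FM n).
- by move=> x _; apply: cvg_EFin; [exact: nearW|exact: Ff].
- by [].
- by move=> n x _ /=; rewrite lee_fin; exact: mbs_le_indic (FM n).
Qed.

Lemma Rd_integral_scale M r f (c : R) : mbs M r f ->
  Rd_integral (fun x => c * f x) = c * Rd_integral f.
Proof. by move=> fM; apply: RintegralZl => //; exact: mbs_integrable fM. Qed.

Lemma mbsB M N r f g : mbs M r f -> mbs N r g -> mbs (M + N) r (fun x => f x - g x).
Proof.
move=> [mf bf f0] [mg bg g0]; split; first exact: measurable_funB.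
  by move=> x; rewrite (le_trans (ler_normB _ _))// lerD.
by move=> x rx; rewrite f0// g0// subrr.
Qed.

Lemma Rd_integral_translate M r f (v : E) : mbs M r f ->
  Rd_integral (fun x => f (x + v)) = Rd_integral f.
Proof.
move=> fM; have [mf _ _] := fM.
rewrite /Rd_integral /Rintegral; congr fine.
have mt := @measurable_translation R d v.
have h := @integral_pushforward _ _ T T R _ mt mu [set: T] (EFin \o (f : T -> R)).
rewrite (_ : (fun x => (f (x + v))%:E) = (EFin \o f) \o (fun x : E => x + v))//.
rewrite -[LHS]h//.
- by apply: eq_measure_integral => A mA _; exact: translation_invariant.
- exact/measurable_EFinP.
- apply: (@mbs_integrable M (r + `|v|)); split=> // [|x|x rx].
  + exact: (measurableT_comp mf mt).
  + by case: fM.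
  + case: fM => _ _; apply; have := ler_normB (x + v) v; rewrite addrK; lra.
Qed.

Lemma blip_mbs M r f : blip M f -> (forall x, r < `|x| -> f x = 0) -> mbs M r f.
Proof.
move=> bf f0; split=> //; last by case: bf.
by apply: continuous_measurable_Rd; exact: blip_continuous bf.
Qed.

(* Translation invariance alone: [q] is the limit of the difference quotients
   of [P], which are dominated since [P] is Lipschitz. *)
Lemma Rd_integral_derive0 M r (P q : E -> R) i :
  blip M P -> (forall x, r < `|x| -> P x = 0) ->
  (forall x, is_derive x (evec R i) P (q x)) -> Rd_integral q = 0.
Proof.
move=> bP P0 dP; have M0 := blip_ge0 bP; have mP := blip_mbs bP P0.
pose F n x := n.+1%:R * (P (x + n.+1%:R^-1 *: evec R i) - P x).
have n1 (n : nat) : 0 < n.+1%:R^-1 :> R by rewrite invr_gt0.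
have ev n : `|n.+1%:R^-1 *: evec R i| <= 1.
  rewrite normrZ (ger0_norm (ltW (n1 n))).
  by apply: mulr_ile1; rewrite ?norm_evec ?(ltW (n1 n))// invf_le1 ?ler1n.
have sP n : mbs M (r + 1) (fun x => P (x + n.+1%:R^-1 *: evec R i)).
  apply: blip_mbs.
    case: bP => b1 b2; split=> // x y; rewrite (le_trans (b2 _ _))//.
    by rewrite opprD addrACA subrr addr0.
  move=> x rx; apply: P0.
  have := ler_normB (x + n.+1%:R^-1 *: evec R i) (n.+1%:R^-1 *: evec R i).
  by rewrite addrK; have := ev n; lra.
have mP' : mbs M (r + 1) P by apply: mbs_le mP => //; rewrite lerDl.
have FM n : mbs M (r + 1) (F n).
  split.
  - apply: measurable_funM => //; apply: measurable_funB.
      by case: (sP n).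
    by case: mP.
  - move=> x; rewrite /F normrM ger0_norm//.
    case: bP => _ b2; rewrite (le_trans (ler_wpM2l _ (b2 _ _)))//.
    rewrite addrAC subrr add0r normrZ (ger0_norm (ltW (n1 n))).
    rewrite mulrCA mulVKf ?pnatr_eq0//.
    by rewrite ler_piMr// norm_evec.
  - move=> x rx; rewrite /F; case: (sP n) => _ _ ->//; case: mP' => _ _ ->//.
    by rewrite subrr mulr0.
have IF n : Rd_integral (F n) = 0.
  rewrite /F (Rd_integral_scale _ (mbsB (sP n) mP')) (Rd_integral_sub (sP n) mP').
  by rewrite (Rd_integral_translate _ mP) subrr mulr0.
have h0 : (n.+1%:R^-1 : R) @[n --> \oo] --> (0 : R)^'.
  move=> A A0.
  have [N _ hN] := @cvg_harmonic R _ A0; exists N => // n /hN; apply.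
  by rewrite /= invr_eq0 pnatr_eq0.
have Fq x : F n x @[n --> \oo] --> q x.
  have [dx <-] := dP x.
  have := cvg_comp _ _ h0 dx.
  rewrite (_ : _ \o _ = F ^~ x)//; apply/funext => n /=.
  by rewrite /F invrK /shift/= [_ + x]addrC.
have := Rd_integral_cvg FM Fq.
rewrite (_ : (fun n => Rd_integral (F n)) = cst 0); last exact/funext.
by move=> /(cvg_lim (@Rhausdorff R)) <-; exact: lim_cst.
Qed.

End Integral.

(** * The change of variables formula up to second order *)

Section Perturbation.
Variables (R : realType) (d : nat).
Local Notation E := 'rV[R]_d.
Implicit Types (f g D : E -> R) (V : E -> E) (M N L r h : R).

Definition supp_in r g := forall x, r < `|x| -> g x = 0.

Definition vlip L V := (forall x, `|V x| <= L) /\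
  (forall x y, `|V x - V y| <= L * `|x - y|).

Lemma vlipD L N V W : vlip L V -> vlip N W -> vlip (L + N) (fun x => V x + W x).
Proof.
move=> [f1 f2] [g1 g2]; split=> [x|x y].
  by rewrite (le_trans (ler_normD _ _))// lerD.
by rewrite opprD addrACA (le_trans (ler_normD _ _))// mulrDl lerD.
Qed.

Lemma vlip_evec N f i : blip N f -> vlip N (fun x => f x *: evec R i).
Proof.
move=> [f1 f2]; split=> [x|x y].
  by rewrite normrZ (le_trans _ (f1 x))// ler_piMr// norm_evec.
rewrite -scalerBl normrZ (le_trans _ (f2 x y))// ler_piMr// norm_evec//.
Qed.

(** First-order model of composition with the flow: an Euler step replaces the flow, and [1 + h * D]
    with [D] the divergence of [V] replaces its Jacobian. *)
Definition pert h V D g x := g (x + h *: V x) * (1 + h * D x).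

Lemma shift_lip L V h x y : 0 <= h <= 1 -> vlip L V ->
  `|(x + h *: V x) - (y + h *: V y)| <= (1 + L) * `|x - y|.
Proof.
move=> /andP[h0 h1] [v1 v2]; rewrite opprD addrACA (le_trans (ler_normD _ _))//.
rewrite mulrDl mul1r lerD// -scalerBr normrZ ger0_norm//.
by rewrite (le_trans _ (v2 x y))// ler_piMl.
Qed.

Lemma vlip_ge0 L V : vlip L V -> 0 <= L.
Proof. by case=> h _; exact: le_trans (h 0). Qed.

Lemma blip_affine L D h : 0 <= h <= 1 -> blip L D -> blip (1 + L) (fun x => 1 + h * D x).
Proof.
move=> /andP[h0 h1] [D1 D2]; split=> [x|x y].
  rewrite (le_trans (ler_normD _ _))// normr1 lerD// normrM ger0_norm//.
  by rewrite (le_trans _ (D1 x))// ler_piMl.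
rewrite opprD addrACA subrr add0r -mulrBr normrM ger0_norm//.
rewrite mulrDl mul1r (le_trans (_ : _ <= L * `|x - y|)) ?lerDr//.
by rewrite (le_trans _ (D2 x y))// ler_piMl.
Qed.

(** What matters is that the constant does not depend on [h]. Composition with a map of Lipschitz
    constant [1 + L] gives [M * (1 + (1 + L))], the weight gives [1 + L], and the product rule of
    [blipM] gives the factor 2. *)
Lemma pert_blip M L V D g h : 0 <= h <= 1 -> vlip L V -> blip L D -> blip M g ->
  blip (2 * ((M * (1 + (1 + L))) * (1 + L))) (pert h V D g).
Proof.
move=> h01 vV bD bg; have L0 := vlip_ge0 vV.
apply: blipM; last exact: blip_affine.
apply: (blip_comp (T := fun x => x + h *: V x)) bg => [|x y]; first by rewrite addr_ge0.
exact: shift_lip.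
Qed.

Lemma supp_comp r L g (T : E -> E) : (forall x, `|T x - x| <= L) ->
  supp_in r g -> supp_in (r + L) (g \o T).
Proof.
move=> TL g0 x rx /=; apply: g0.
have := ler_normB (T x) (T x - x); rewrite subKr; have := TL x; lra.
Qed.

Lemma pert_supp r L V D g h : 0 <= h <= 1 -> vlip L V -> supp_in r g ->
  supp_in (r + L) (pert h V D g).
Proof.
move=> /andP[h0 h1] [v1 _] g0 x rx.
have hV y : `|(y + h *: V y) - y| <= L.
  rewrite addrAC subrr add0r normrZ ger0_norm//.
  by rewrite (le_trans _ (v1 y))// ler_piMl.
have := supp_comp (T := fun x => x + h *: V x) hV g0 rx.
by rewrite /pert /= => ->; rewrite mul0r.
Qed.

End Perturbation.

(** * Exact formula for one shear, second-order formula for a full Euler step *)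

Section ApproximateChangeOfVariables.
Variables (R : realType) (d : nat).
Local Notation E := 'rV[R]_d.
Local Notation T := (Rd_meas R d).
Variable (mu : {measure set T -> \bar R}).
Hypothesis Hmu : is_lebesgue_Rd mu.
Implicit Types (f g : E -> R) (M N r h : R).

Lemma prim_eq0 (f : R -> R) a : continuous f ->
  (forall t, `|t| <= `|a| -> f t = 0) -> prim f a = 0.
Proof.
move=> cf f0; have [s [sa]] := exists_mean_value a (fun t => is_derive_prim t cf).
by rewrite prim0 subr0 f0// mul0r.
Qed.

(* [P y] is the integral of [g] along the segment from [y] to [y + h c(y) e_i]:
   its [i]-th derivative is the difference of the two integrands. *)
Lemma Rd_integral_shear M N r g (c c' : E -> R) i h :
  blip M g -> supp_in r g -> blip N c -> blip N c' ->
  (forall x, is_derive x (evec R i) c (c' x)) -> 0 <= h <= 1 ->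
  Rd_integral mu (pert h (fun x => c x *: evec R i) c' g) = Rd_integral mu g.
Proof.
move=> bg g0 bc bc' dc h01; have /andP[h0 h1] := h01.
have M0 := blip_ge0 bg; have N0 := blip_ge0 bc.
have vV := vlip_evec i bc.
pose G (y : E) (s : R) := g (y + s *: evec R i).
have cg : continuous g by exact: blip_continuous bg.
have Glip y y' s s' : `|G y s - G y' s'| <= M * (`|y - y'| + `|s - s'|).
  case: bg => _ b2; rewrite (le_trans (b2 _ _))// ler_wpM2l//.
  rewrite opprD addrACA (le_trans (ler_normD _ _))// lerD2l -scalerBl normrZ.
  by rewrite ler_piMr// norm_evec.
have cG y : continuous (G y).
  move=> s; apply/(@cvgrPdist_le _ R^o) => e e0; near=> t.
  rewrite (le_trans (Glip y y s t))// subrr normr0 add0r.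
  have st : `|s - t| <= e / (M + 1).
    near: t; apply: (@cvgr_dist_le _ _ _ (nbhs s)); first exact: cvg_id.
    by rewrite divr_gt0// ltr_wpDl.
  rewrite (le_trans (ler_wpM2l M0 st))// mulrA ler_pdivrMr ?ltr_wpDl//.
  by rewrite mulrC ler_wpM2l ?lerDl ?ltW.
have GM y s : `|G y s| <= M by case: bg => + _; exact.
(* Moving the base point along [e_i] only shifts the parameter of the primitive. *)
have Gshift y t a : prim (G (y + t *: evec R i)) a = prim (G y) (t + a) - prim (G y) t.
  have dQ (s : R) : is_derive s 1 (fun a => prim (G y) (t + a)) (G (y + t *: evec R i) s).
    have h2 := is_derive_prim (t + s) (cG y).
    have h3 : is_derive s (1 : R) (fun a => t + a) 1.
      have := is_deriveD (is_derive_cst t s (1 : R)) (is_derive_id s (1 : R)).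
      by rewrite add0r.
    apply: (is_derive_eq (is_derive1_comp h2 h3)).
    by rewrite mulr1 /G scalerDl addrA.
  by rewrite (primE a dQ (cG _)) addr0.
pose P y := prim (G y) (h * c y).
have hcN y : `|h * c y| <= N.
  rewrite normrM ger0_norm//; case: bc => b1 _.
  by rewrite (le_trans _ (b1 y))// ler_piMl.
have bP : blip (2 * (M * N)) P.
  split=> [y|y y'].
    rewrite (le_trans (prim_norm _ (cG y) (GM y)))//.
    have := ler_wpM2l M0 (hcN y); have := mulr_ge0 M0 N0; lra.
  have e1 : `|prim (G y) (h * c y) - prim (G y) (h * c y')| <= M * (N * `|y - y'|).
    rewrite (le_trans (MVT_norm _ _ (fun t => is_derive_prim t (cG y)) (GM y)))//.
    rewrite ler_wpM2l// -mulrBr normrM ger0_norm//; case: bc => _ b2.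
    by rewrite (le_trans _ (b2 _ _))// ler_piMl.
  have e2 : `|prim (G y) (h * c y') - prim (G y') (h * c y')| <= (M * `|y - y'|) * N.
    apply: (le_trans (@primB_norm _ _ _ _ (M * `|y - y'|) (cG y) (cG y') _)).
      by move=> t; have := Glip y y' t t; rewrite subrr normr0 addr0.
    by rewrite ler_wpM2l// mulr_ge0.
  have := ler_normD (prim (G y) (h * c y) - prim (G y) (h * c y'))
    (prim (G y) (h * c y') - prim (G y') (h * c y')).
  rewrite addrA subrK => /le_trans; apply; lra.
have P0 : supp_in (r + N) P.
  move=> y ry; apply: prim_eq0; first exact: cG.
  move=> t th; apply: g0.
  have := ler_normB (y + t *: evec R i) (t *: evec R i); rewrite addrK normrZ.
  have := norm_evec R i; have := hcN y.
  have : `|t| * `|evec R i| <= `|t| by rewrite ler_piMr// norm_evec.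
  lra.
pose q y := pert h (fun x => c x *: evec R i) c' g y - g y.
have dP y : is_derive y (evec R i) P (q y).
  rewrite -[y]addr0 -[X in y + X](scale0r (evec R i)); apply/is_derive_line.
  rewrite scale0r addr0.
  (* With [Phi = prim (G y)] fixed, [P] restricted to the line is [Phi (s + h c) - Phi s].
     Differentiating it requires no derivative of [g], which is merely Lipschitz. *)
  have -> : (fun s : R => P (y + s *: evec R i)) =
     (prim (G y) \o (fun s => s + h * c (y + s *: evec R i))) - prim (G y).
    by apply/funext => s; rewrite /P Gshift.
  have dc0 : is_derive (0 : R) 1 (fun s : R => c (y + s *: evec R i)) (c' y).
    by apply/is_derive_line; rewrite scale0r addr0.
  have d1 : is_derive (0 : R) 1 (fun s => s + h * c (y + s *: evec R i)) (1 + h * c' y).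
    have e1 := is_deriveM (is_derive_cst h (0 : R) 1) dc0.
    apply: (is_derive_eq (is_deriveD (is_derive_id (0 : R) 1) e1)).
    by rewrite scaler0 addr0.
  have d2 := is_derive_prim (0 + h * c (y + 0 *: evec R i)) (cG y).
  have d3 := is_derive_prim 0 (cG y).
  have d4 := @is_derive1_comp _ (prim (G y))
    (fun s => s + h * c (y + s *: evec R i)) 0 _ _ d2 d1.
  apply: (is_derive_eq (is_deriveB d4 d3)).
  by rewrite /q /pert /G add0r scale0r addr0 scalerA.
have := Rd_integral_derive0 Hmu bP P0 dP.
have m1 := blip_mbs (pert_blip h01 vV bc' bg) (pert_supp c' h01 vV g0).
have m2 := blip_mbs bg g0.
by rewrite (Rd_integral_sub Hmu m1 m2) => /eqP; rewrite subr_eq0 => /eqP.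
Unshelve. all: by end_near. Qed.

Variables (N : R) (b db : 'I_d -> E -> R).
Hypothesis bb : forall i, blip N (b i).
Hypothesis bdb : forall i, blip N (db i).
Hypothesis dbP : forall i x, is_derive x (evec R i) (b i) (db i x).

(** The sum runs over a list so that coordinates can be added one at a time by induction. *)
Definition field (s : seq 'I_d) x : E := \sum_(i <- s) b i x *: evec R i.
Definition divf (s : seq 'I_d) x : R := \sum_(i <- s) db i x.

Lemma vlip_field s : vlip ((size s)%:R * N) (field s).
Proof.
elim: s => [|i s IH].
  rewrite mul0r; split=> [x|x y]; rewrite /field !big_nil ?normr0//.
  by rewrite subrr normr0 mul0r.
rewrite [size _]/= -nat1r mulrDl mul1r.
rewrite (_ : field _ = fun x => b i x *: evec R i + field s x); last first.
  by apply/funext => x; rewrite /field big_cons.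
by apply: vlipD => //; exact: vlip_evec.
Qed.

Lemma blip_divf s : blip ((size s)%:R * N) (divf s).
Proof.
elim: s => [|i s IH].
  rewrite mul0r; split=> [x|x y]; rewrite /divf !big_nil ?normr0//.
  by rewrite subrr normr0 mul0r.
rewrite [size _]/= -nat1r mulrDl mul1r.
rewrite (_ : divf _ = fun x => db i x + divf s x); last first.
  by apply/funext => x; rewrite /divf big_cons.
exact: blipD.
Qed.

(** Shearing [g] in direction [i] preserves its integral exactly, and the induction hypothesis is
    applied to the sheared function [G]. This is why [K] must be uniform in [g]: only the bounds and
    the support radius of [G] are controlled. Composing the two steps differs from the joint step by
    [O(h^2)], since [b i] and [db i] are evaluated at [z] instead of [x], at distance [O(h)], and
    the product of the weights adds a term in [h ^+ 2]. *)
Lemma Rd_integral_pert_field s M r : exists2 K, 0 <= K & forall g, blip M g -> supp_in r g ->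
  forall h, 0 <= h <= 1 ->
  `|Rd_integral mu (pert h (field s) (divf s) g) - Rd_integral mu g| <= K * h ^+ 2.
Proof.
elim: s M r => [|i s IH] M r.
  exists 0 => // g _ _ h _; rewrite mul0r (_ : pert _ _ _ _ = g) ?subrr ?normr0//.
  by apply/funext => x; rewrite /pert /field /divf !big_nil scaler0 mulr0 !addr0 mulr1.
have [K1 K10 HK1] := IH (2 * ((M * (1 + (1 + N))) * (1 + N))) (r + N).
pose L := (size s)%:R * N.
have N0 : 0 <= N := blip_ge0 (bb i).
have L0 : 0 <= L by rewrite mulr_ge0.
(* The first summand accounts for the weights [w1 - w2], the second for the displacement [p - q]
   times the bound [1 + N + L] on [w2]. The absolute value is there because [0 <= M] is known only
   once some [g] is given. *)
pose C := `|M| * (2 * L * N) + `|M| * (N * L) * (1 + N + L).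
have C0 : 0 <= C by rewrite addr_ge0// !mulr_ge0// ?addr_ge0.
exists (K1 + C * vol mu (r + N + L)).
  by rewrite addr_ge0// mulr_ge0// vol_ge0.
move=> g bg g0 h h01; have /andP[h0 h1] := h01.
have M0 := blip_ge0 bg.
have vi := vlip_evec i (bb i).
pose G := pert h (fun x => b i x *: evec R i) (db i) g.
have bG : blip (2 * ((M * (1 + (1 + N))) * (1 + N))) G by exact: pert_blip.
have G0 : supp_in (r + N) G by exact: pert_supp.
have IG : Rd_integral mu G = Rd_integral mu g := Rd_integral_shear bg g0 (bb i) (bdb i) (dbP i) h01.
have := HK1 G bG G0 h h01; rewrite IG => hK.
have m1 := blip_mbs (pert_blip h01 (vlip_field s) (blip_divf s) bG)
  (pert_supp (divf s) h01 (vlip_field s) G0).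
have m2 := blip_mbs (pert_blip h01 (vlip_field (i :: s)) (blip_divf (i :: s)) bg)
  (pert_supp (divf (i :: s)) h01 (vlip_field (i :: s)) g0).
have {}m2 : mbs (2 * (M * (1 + (1 + (size (i :: s))%:R * N)) *
   (1 + (size (i :: s))%:R * N))) (r + N + L) (pert h (field (i :: s)) (divf (i :: s)) g).
  by apply: mbs_le m2 => //; rewrite [size _]/= -nat1r mulrDl mul1r addrA.
have e x : `|pert h (field s) (divf s) G x - pert h (field (i :: s)) (divf (i :: s)) g x|
    <= C * h ^+ 2.
  rewrite /G /pert /field /divf !big_cons -/(field s x) -/(divf s x).
  set z := x + h *: field s x.
  have zx : `|z - x| <= h * L.
    rewrite /z addrAC subrr add0r normrZ ger0_norm// ler_wpM2l//.
    by case: (vlip_field s).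
  have [b1 b2] := bb i; have [db1 db2] := bdb i; have [g1 g2] := bg.
  have D1 : `|divf s x| <= L by case: (blip_divf s).
  have -> : x + h *: (b i x *: evec R i + field s x) = z + h *: (b i x *: evec R i).
    by rewrite /z scalerDr addrA addrAC.
  set p := z + h *: (b i z *: evec R i); set q := z + h *: (b i x *: evec R i).
  have pq : `|p - q| <= h ^+ 2 * (N * L).
    rewrite /p /q opprD addrACA subrr add0r -scalerBr -scalerBl !normrZ ger0_norm//.
    rewrite expr2 -mulrA ler_wpM2l// (@le_trans _ _ `|b i z - b i x|)//.
      by rewrite ler_piMr// norm_evec.
    by rewrite (le_trans (b2 _ _))// mulrCA ler_wpM2l.
  rewrite -[X in X - _]mulrA.
  set w1 := (1 + h * db i z) * _; set w2 := 1 + h * (db i x + divf s x).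
  have w12 : `|w1 - w2| <= h ^+ 2 * (2 * L * N).
    have -> : w1 - w2 = h * (db i z - db i x) + h ^+ 2 * (db i z * divf s x).
      rewrite /w1 /w2; ring.
    rewrite (le_trans (ler_normD _ _))// normrM (ger0_norm h0) normrM.
    rewrite (ger0_norm (sqr_ge0 h)) normrM.
    have e1 : `|db i z - db i x| <= N * (h * L).
      by rewrite (le_trans (db2 _ _))// ler_wpM2l.
    have e2 : `|db i z| * `|divf s x| <= N * L by rewrite ler_pM.
    have := ler_wpM2l h0 e1; have := ler_wpM2l (sqr_ge0 h) e2; lra.
  have w2b : `|w2| <= 1 + N + L.
    rewrite /w2 mulrDr addrA (le_trans (ler_normD _ _))// lerD//.
      rewrite (le_trans (ler_normD _ _))// normr1 lerD// normrM ger0_norm//.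
      by rewrite (le_trans _ (db1 x))// ler_piMl.
    by rewrite normrM ger0_norm// (le_trans _ D1)// ler_piMl.
  have -> : g p * w1 - g q * w2 = g p * (w1 - w2) + (g p - g q) * w2 by ring.
  rewrite (le_trans (ler_normD _ _))// !normrM.
  have a1 : `|g p| * `|w1 - w2| <= M * (h ^+ 2 * (2 * L * N)) by rewrite ler_pM.
  have a2 : `|g p - g q| * `|w2| <= M * (h ^+ 2 * (N * L)) * (1 + N + L).
    by rewrite ler_pM// (le_trans (g2 _ _))// ler_wpM2l.
  rewrite /C (ger0_norm M0); lra.
have h4 := Rd_integral_dist Hmu m1 m2 e.
rewrite (le_trans (ler_distD (Rd_integral mu (pert h (field s) (divf s) G)) _ _))//.
by rewrite mulrDl addrC lerD// distrC (le_trans h4)// mulrAC.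
Qed.

End ApproximateChangeOfVariables.

(** * Flows, Liouville's formula and the invariant density *)

Section ODE.
Variables (R : realType) (d : nat).
Local Notation E := 'rV[R]_d.

Lemma is_derive_coord (c : R -> E) (t : R) w i :
  is_derive t 1 c w -> is_derive t 1 (fun s => c s ord0 i) (w ord0 i).
Proof.
move=> [dc <-]; apply: DeriveDef; first by move/derivable_mxP : dc.
by rewrite derive_mx// mxE.
Qed.

Lemma is_derive_scalel (v : E) (t : R) : is_derive t 1 (fun s : R => s *: v) v.
Proof.
apply: is_derive_cvg; apply: cvg_near_cst; near=> h.
rewrite /shift/= -scalerBl addrK [h *: 1]mulr1 scalerA mulVf ?scale1r//.
by near: h; exact: nbhs_dnbhs_neq.
Unshelve. all: by end_near. Qed.

Lemma MVT_vec (c : R -> E) (w : R -> E) a t M : 0 <= M -> a <= t ->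
  (forall s : R, is_derive s 1 c (w s)) -> (forall s, a <= s <= t -> `|w s| <= M) ->
  `|c t - c a| <= M * (t - a).
Proof.
move=> M0 at_ dc wM; apply: norm_le_coord => [|i]; first by rewrite mulr_ge0// subr_ge0.
have di (s : R) : is_derive s 1 (fun s => c s ord0 i) (w s ord0 i).
  exact: is_derive_coord.
have := @MVT_le _ (fun s => c s ord0 i) (fun s => w s ord0 i) a t M at_ di.
rewrite !mxE; apply => s /wM; apply: le_trans; exact: coord_le_norm.
Qed.

(** Lipschitz constant of the flow at time [t]. Gronwall's inequality for squared distances would
    give [sqrt d * exp (d * L * |t|)]; this larger expression avoids the square root. *)
Definition growth (L t : R) : R := (1 + d%:R) * expR (d%:R * (2 * L) * `|t|).

Lemma growth_ge0 L t : 0 <= growth L t.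
Proof. by rewrite mulr_ge0 ?expR_ge0// addr_ge0. Qed.

Lemma growth_le L s t : 0 <= L -> `|s| <= `|t| -> growth L s <= growth L t.
Proof.
by move=> L0 st; rewrite ler_wpM2l ?addr_ge0// ler_expR ler_wpM2l// !mulr_ge0.
Qed.

(** The sup norm is not differentiable, so Gronwall's inequality is applied to the squared Euclidean
    distance [e], which lies between the square of the sup norm and [d] times it. *)
Lemma ode_lipschitz (L : R) (V : E -> E) (c1 c2 : R -> E) (t : R) :
  (forall x y, `|V x - V y| <= L * `|x - y|) -> 0 <= L ->
  (forall s : R, is_derive s 1 c1 (V (c1 s))) ->
  (forall s : R, is_derive s 1 c2 (V (c2 s))) ->
  `|c1 t - c2 t| <= growth L t * `|c1 0 - c2 0|.
Proof.
move=> VL L0 dc1 dc2.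
pose e s := \sum_(i < d) (c1 s ord0 i - c2 s ord0 i) ^+ 2.
pose e' s := \sum_(i < d) (2 * (c1 s ord0 i - c2 s ord0 i)) *
  (V (c1 s) ord0 i - V (c2 s) ord0 i).
have de (s : R) : is_derive s 1 e (e' s).
  have -> : e = \sum_(i < d) (fun s => (c1 s ord0 i - c2 s ord0 i) ^+ 2).
    by apply/funext => y; rewrite fct_sumE.
  apply: is_derive_sum => i.
  have h := is_deriveB (is_derive_coord i (dc1 s)) (is_derive_coord i (dc2 s)).
  have h2 := is_deriveX 2 h.
  apply: (is_derive_eq h2).
  by rewrite /= expr1.
have ne s : `|c1 s - c2 s| ^+ 2 <= e s.
  have [->|nz] := eqVneq (c1 s - c2 s) 0.
    by rewrite normr0 expr0n/= sumr_ge0// => i _; rewrite sqr_ge0.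
  have : mx_norm (c1 s - c2 s) != 0.
    by apply: contra_neq nz; exact: mx_norm_eq0.
  move=> /mx_norm_neq0[[a i] /=]; rewrite ord1 => hi.
  have -> : `|c1 s - c2 s| = `|(c1 s - c2 s) ord0 i| by exact: hi.
  rewrite real_normK ?num_real// !mxE /e (bigD1 i)//= lerDl sumr_ge0// => j _.
  exact: sqr_ge0.
have ce s i : `|c1 s ord0 i - c2 s ord0 i| <= `|c1 s - c2 s|.
  by have := coord_le_norm (c1 s - c2 s) i; rewrite !mxE.
have e'e s : `|e' s| <= d%:R * (2 * L) * e s.
  rewrite (le_trans (ler_norm_sum _ _ _))//.
  have -> : d%:R * (2 * L) * e s = \sum_(i < d) 2 * L * e s.
    by rewrite sumr_const card_ord -mulrA mulr_natl.
  apply: ler_sum => i _; rewrite normrM normrM ger0_norm//.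
  have h1 : `|V (c1 s) ord0 i - V (c2 s) ord0 i| <= L * `|c1 s - c2 s|.
    rewrite (le_trans _ (VL _ _))//.
    by have := coord_le_norm (V (c1 s) - V (c2 s)) i; rewrite !mxE.
  have h2 : `|c1 s ord0 i - c2 s ord0 i| * `|V (c1 s) ord0 i - V (c2 s) ord0 i| <=
    `|c1 s - c2 s| * (L * `|c1 s - c2 s|) by rewrite ler_pM.
  have := ler_wpM2l L0 (ne s); rewrite expr2; lra.
have := gronwall t de e'e.
have e0 : e 0 <= d%:R * `|c1 0 - c2 0| ^+ 2.
  have -> : d%:R * `|c1 0 - c2 0| ^+ 2 = \sum_(i < d) `|c1 0 - c2 0| ^+ 2.
    by rewrite sumr_const card_ord mulr_natl.
  apply: ler_sum => i _; rewrite -[leLHS]real_normK ?num_real//.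
  by rewrite lerXn2r ?nnegrE.
set k := expR _ => h.
have k1 : 1 <= k by rewrite /k -[leLHS]expR0 ler_expR !mulr_ge0.
rewrite -[leLHS]ger0_norm// -[leRHS]ger0_norm ?mulr_ge0 ?growth_ge0//.
rewrite -[leLHS]sqrtr_sqr -[leRHS]sqrtr_sqr ler_wsqrtr//.
apply: (le_trans (ne t)); apply: (le_trans h).
rewrite exprMn /growth -/k.
apply: (@le_trans _ _ (k * (d%:R * `|c1 0 - c2 0| ^+ 2))).
  by rewrite ler_wpM2l// (le_trans _ k1).
rewrite mulrA ler_wpM2r ?sqr_ge0// exprMn [leLHS]mulrC.
have k0 : 0 <= k by rewrite (le_trans _ k1).
have d0 : 0 <= d%:R :> R by [].
apply: ler_pM => //; last by rewrite expr2 ler_peMr.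
rewrite expr2; have := mulr_ge0 d0 d0; lra.
Qed.

Lemma expR_taylor2 (a A : R) : `|a| <= A -> `|expR a - 1 - a| <= expR A * a ^+ 2.
Proof.
move=> aA.
have h (s : R) : is_derive s 1 (fun s => expR s - s) (expR s - 1).
  exact: is_deriveB (is_derive_expR s) (is_derive_id s (1 : R)).
have [s [sa]] := exists_mean_value a h.
rewrite expR0 subr0 addrAC => ->; rewrite normrM.
rewrite -[a ^+ 2]real_normK ?num_real// expr2 mulrA ler_wpM2r//.
have := @expR_lip R s 0 A; rewrite normr0 subr0 expR0 => /(_ _ _) h2.
have A0 : 0 <= A by exact: le_trans aA.
by rewrite (le_trans (h2 (le_trans sa aA) A0))// ler_wpM2l ?expR_ge0.
Qed.

End ODE.

(** * The flow of a bounded Lipschitz field *)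

Section Flow.
Variables (R : realType) (d : nat).
Local Notation E := 'rV[R]_d.
Local Notation T := (Rd_meas R d).
Variable (mu : {measure set T -> \bar R}).
Hypothesis Hmu : is_lebesgue_Rd mu.
Variables (N : R) (b db : 'I_d -> E -> R).
Hypothesis bb : forall i, blip N (b i).
Hypothesis bdb : forall i, blip N (db i).
Hypothesis dbP : forall i x, is_derive x (evec R i) (b i) (db i x).

Let V := field b (index_enum 'I_d).
Let dv := divf db (index_enum 'I_d).
Let L := (size (index_enum 'I_d))%:R * N.

Variable X : R -> E -> E.
Hypothesis X0 : forall x, X 0 x = x.
Hypothesis dX : forall x (t : R), is_derive t 1 (fun s => X s x) (V (X t x)).

Let vV : vlip L V. Proof. exact: vlip_field. Qed.
Let bdv : blip L dv. Proof. exact: blip_divf. Qed.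
Let L0 : 0 <= L. Proof. exact: blip_ge0 bdv. Qed.

Lemma flow_lip t x y : `|X t x - X t y| <= growth d L t * `|x - y|.
Proof.
have := @ode_lipschitz _ _ L V (X^~ x) (X^~ y) t (proj2 vV) L0 (dX x) (dX y).
by rewrite !X0.
Qed.

Lemma flow_unique c x t : (forall s : R, is_derive s 1 c (V (c s))) -> c 0 = x ->
  c t = X t x.
Proof.
move=> dc c0; apply/eqP; rewrite -subr_eq0 -normr_le0.
have := @ode_lipschitz _ _ L V c (X^~ x) t (proj2 vV) L0 dc (dX x).
by rewrite c0 X0 subrr normr0 mulr0.
Qed.

Lemma flow_add t s x : X (t + s) x = X t (X s x).
Proof.
apply: (@flow_unique (fun t => X (t + s) x)); last by rewrite add0r.
move=> y; have := dX x (y + s).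
have eqq (w : E) : is_derive (y + s) 1 (fun s0 => X s0 x) w ->
    is_derive y 1 (fun t0 => X (t0 + s) x) w.
  move=> [h1 <-].
  have e1 : (fun h : R => h^-1 *: (((fun t0 => X (t0 + s) x) \o shift y) (h *: (1 : R))
       - X (y + s) x)) =
     (fun h => h^-1 *: (((fun t0 => X t0 x) \o shift (y + s)) (h *: (1 : R)) - X (y + s) x)).
    by apply/funext => h; rewrite /= /shift/= addrA.
  by apply: is_derive_cvg; rewrite e1; exact: h1.
exact: eqq.
Qed.

Lemma flow_translate (e : E) t x : (forall y, V (y + e) = V y) ->
  X t (x + e) = X t x + e.
Proof.
move=> Ve; symmetry; apply: (@flow_unique (fun t => X t x + e)); last by rewrite X0.
move=> s; rewrite Ve.
have := is_deriveD (dX x s) (is_derive_cst e s (1 : R)).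
by rewrite addr0.
Qed.

Lemma flow_dist t x : 0 <= t -> `|X t x - x| <= L * t.
Proof.
move=> t0; have := @MVT_vec _ _ (X^~ x) (fun s => V (X s x)) 0 t L L0 t0 (dX x).
by rewrite X0 subr0; apply => s _; case: vV.
Qed.

Lemma flow_distN t x : 0 <= t -> `|X (- t) x - x| <= L * t.
Proof.
move=> t0; have := flow_dist (X (- t) x) t0.
by rewrite -flow_add subrr X0 distrC.
Qed.

Lemma flow_expand t x : 0 <= t -> `|X t x - (x + t *: V x)| <= L * L * t ^+ 2.
Proof.
move=> t0.
have dc (s : R) : is_derive s 1 (fun s => X s x - s *: V x) (V (X s x) - V x).
  have h := is_derive_scalel (V x) s.
  exact: (is_deriveB (dX x s) h).
have [_ v2] := vV.
have -> : X t x - (x + t *: V x) = (X t x - t *: V x) - (X 0 x - 0 *: V x).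
  by rewrite X0 scale0r subr0 opprD addrA addrAC.
have -> : L * L * t ^+ 2 = L * (L * t) * (t - 0) by ring.
apply: (MVT_vec _ t0 dc); first by apply: mulr_ge0 => //; apply: mulr_ge0.
move=> s /andP[s0 st]; rewrite (le_trans (v2 _ _))// ler_wpM2l//.
by rewrite (le_trans (flow_dist x s0))// ler_wpM2l.
Qed.

(** * The logarithm of the Jacobian *)

Let rate x (s : R) := dv (X s x).

Let continuous_rate x : continuous (rate x).
Proof.
move=> s; apply: (@continuous_comp _ _ _ (fun s => X s x) dv).
  apply: differentiable_continuous; apply/derivable1_diffP.
  by have [] := dX x s.
have h : continuous dv by exact: blip_continuous bdv.
exact: h.
Qed.

(** By definition only the integral of the divergence along the orbit; that its exponential acts as
    a Jacobian is established by [Rd_integral_transported]. *)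
Definition logJ t x : R := prim (rate x) t.

Lemma logJ_abs t x : `|logJ t x| <= L * `|t|.
Proof.
apply: prim_norm; first exact: continuous_rate.
by move=> s; case: bdv => + _; exact.
Qed.

Lemma logJ_dist t s x : `|logJ t x - logJ s x| <= L * `|t - s|.
Proof.
apply: (MVT_norm _ _ (fun t => is_derive_prim t (@continuous_rate x))) => y.
by case: bdv => + _; exact.
Qed.

Lemma logJ_add t s x : logJ (t + s) x = logJ s x + logJ t (X s x).
Proof.
have dQ (y : R) : is_derive y 1 (fun t => logJ (t + s) x) (rate (X s x) y).
  have h2 := is_derive_prim (y + s) (@continuous_rate x).
  have h3 : is_derive y (1 : R) (fun a => a + s) 1.
    have := is_deriveD (is_derive_id y (1 : R)) (is_derive_cst s y (1 : R)).
    by rewrite addr0.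
  apply: (is_derive_eq (@is_derive1_comp _ (logJ^~ x) (fun a => a + s) y _ _ h2 h3)).
  by rewrite mulr1 /rate flow_add.
by rewrite [logJ t _](primE t dQ (@continuous_rate (X s x))) add0r [RHS]addrC subrK.
Qed.

Lemma logJ0 x : logJ 0 x = 0. Proof. exact: prim0. Qed.

Lemma logJ_translate (e : E) t x : (forall y, V (y + e) = V y) ->
  (forall y, dv (y + e) = dv y) -> logJ t (x + e) = logJ t x.
Proof.
move=> Ve de; rewrite /logJ; congr (prim _ t); apply/funext => s.
by rewrite /rate flow_translate.
Qed.

Lemma logJ_expand t x : 0 <= t -> `|logJ t x - t * dv x| <= L * L * t ^+ 2.
Proof.
move=> t0.
have dc (s : R) : is_derive s 1 (fun s => logJ s x - s * dv x) (rate x s - dv x).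
  have h := is_deriveM (is_derive_id s (1 : R)) (is_derive_cst (dv x) s (1 : R)).
  apply: (is_derive_eq (is_deriveB (is_derive_prim s (@continuous_rate x)) h)).
  by rewrite scaler0 add0r [_ *: 1]mulr1.
have := @MVT_le _ _ _ 0 t (L * (L * t)) t0 dc.
rewrite logJ0 mul0r !subr0 (_ : L * (L * t) * t = L * L * t ^+ 2); last by ring.
apply => s /andP[s0 st]; have [_ dv2] := bdv.
rewrite /rate (le_trans (dv2 _ _))// ler_wpM2l//.
by rewrite (le_trans (flow_dist x s0))// ler_wpM2l.
Qed.

Lemma logJ_blip t S : 0 <= t <= S -> blip (L * S * (1 + growth d L S)) (logJ t).
Proof.
move=> /andP[t0 tS]; have S0 := le_trans t0 tS.
have Lp := L0; have LS := mulr_ge0 L0 S0.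
have g0 := growth_ge0 d L S.
split=> [x|x y].
  rewrite (le_trans (logJ_abs t x))// ger0_norm// (@le_trans _ _ (L * S))//.
    by rewrite ler_wpM2l.
  by rewrite ler_peMr// lerDl.
have := @primB_le _ (rate x) (rate y) t (L * (growth d L S * `|x - y|)) t0
  (@continuous_rate x) (@continuous_rate y).
rewrite -/(logJ t x) -/(logJ t y) => h; apply: (le_trans (h _)).
  move=> s /andP[s0 st]; case: bdv => _ dv2.
  rewrite (le_trans (dv2 _ _))// ler_wpM2l// (le_trans (flow_lip _ _ _))//.
  rewrite ler_wpM2r// growth_le// !ger0_norm// (le_trans st)//.
have a1 : L * (growth d L S * `|x - y|) * t <= L * (growth d L S * `|x - y|) * S.
  by rewrite ler_wpM2l//; apply: mulr_ge0 => //; apply: mulr_ge0.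
have a2 := mulr_ge0 LS (normr_ge0 (x - y)).
lra.
Qed.

(** * Liouville's formula *)

Definition transported t (g : E -> R) x := g (X t x) * expR (logJ t x).

(** This semigroup law is what allows a time interval to be cut into short steps. *)
Lemma transported_add t s g x :
  transported (t + s) g x = transported s (transported t g) x.
Proof. by rewrite /transported flow_add logJ_add expRD [expR (logJ s x) * _]mulrC mulrA. Qed.

(** The constant depends on the horizon [S] and not on [t], so every intermediate function up to
    time [S] belongs to one class. *)
Lemma transported_blip M t S g : 0 <= t <= S -> blip M g ->
  blip (2 * (M * (1 + growth d L S) *
    (expR (L * S * (1 + growth d L S)) * (1 + L * S * (1 + growth d L S)))))
  (transported t g).
Proof.
move=> tS bg; apply: blipM; last exact/blip_expR/logJ_blip.
apply: (blip_comp (T := X t)) bg => [|x y]; first exact: growth_ge0.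
rewrite (le_trans (flow_lip _ _ _))// ler_wpM2r// growth_le//.
by move/andP : tS => [t0 tS]; rewrite !ger0_norm// (le_trans t0).
Qed.

Lemma transported_supp r t S g : 0 <= t <= S -> supp_in r g ->
  supp_in (r + L * S) (transported t g).
Proof.
move=> /andP[t0 tS] g0 x rx.
have h : forall y, `|X t y - y| <= L * S.
  by move=> y; rewrite (le_trans (flow_dist y t0))// ler_wpM2l.
by have := supp_comp h g0 rx; rewrite /transported /= => ->; rewrite mul0r.
Qed.

Lemma Rd_integral_transported_step M r : exists2 K, 0 <= K &
  forall g, blip M g -> supp_in r g -> forall h, 0 <= h <= 1 ->
  `|Rd_integral mu (transported h g) - Rd_integral mu g| <= K * h ^+ 2.
Proof.
have [K1 K10 hK1] := Rd_integral_pert_field Hmu bb bdb dbP (index_enum 'I_d) M r.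
pose e := expR L.
have e0 : 0 <= e by exact: expR_ge0.
have LL : 0 <= L * L by rewrite mulr_ge0.
(* The first summand bounds the effect of replacing the flow by an Euler step. In the second,
   [L * L * e] is the Taylor remainder of the exponential and [L * L] the error of [logJ h x]
   against [h * dv x]. *)
pose C := `|M| * (L * L) * e + `|M| * (L * L * (e + 1)).
have C0 : 0 <= C.
  by apply: addr_ge0; apply: mulr_ge0 => //; apply: mulr_ge0 => //; apply: addr_ge0.
exists (K1 + C * vol mu (r + L)); first by rewrite addr_ge0// mulr_ge0// vol_ge0.
move=> g bg g0 h h01; have /andP[h0 h1] := h01; have M0 := blip_ge0 bg.
have Lp := L0.
have m1 := blip_mbs (pert_blip h01 vV bdv bg) (pert_supp dv h01 vV g0).
have s2 := transported_supp h01 g0; rewrite mulr1 in s2.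
have m2 := blip_mbs (transported_blip h01 bg) s2.
have ex x : `|transported h g x - pert h V dv g x| <= C * h ^+ 2.
  have [g1 g2] := bg.
  have Fh : `|logJ h x| <= L * h by rewrite (le_trans (logJ_abs h x))// ger0_norm.
  have FL : `|logJ h x| <= L by rewrite (le_trans Fh)// ler_piMr.
  have J1 : `|expR (logJ h x)| <= e.
    by rewrite ger0_norm ?expR_ge0// ler_expR (le_trans (ler_norm _)).
  have J2 : `|expR (logJ h x) - (1 + h * dv x)| <= L * L * (e + 1) * h ^+ 2.
    have t1 := expR_taylor2 FL; have t2 := logJ_expand x h0.
    have t3 : logJ h x ^+ 2 <= L * L * h ^+ 2.
      rewrite -[leLHS]real_normK ?num_real// -expr2 -exprMn lerXn2r ?nnegrE//.
      by rewrite mulr_ge0.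
    have t4 := ler_wpM2l e0 t3.
    have -> : expR (logJ h x) - (1 + h * dv x) =
      (expR (logJ h x) - 1 - logJ h x) + (logJ h x - h * dv x) by ring.
    by rewrite (le_trans (ler_normD _ _))//; rewrite -/e in t1; lra.
  have X1 : `|g (X h x) - g (x + h *: V x)| <= M * (L * L * h ^+ 2).
    by rewrite (le_trans (g2 _ _))// ler_wpM2l// flow_expand.
  rewrite /transported /pert.
  set p := g (X h x) in X1 *; set q := g (x + _) in X1 *.
  have -> : p * expR (logJ h x) - q * (1 + h * dv x) =
    (p - q) * expR (logJ h x) + q * (expR (logJ h x) - (1 + h * dv x)) by ring.
  rewrite (le_trans (ler_normD _ _))// !normrM.
  have a1 : `|p - q| * `|expR (logJ h x)| <= M * (L * L * h ^+ 2) * e by rewrite ler_pM.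
  have a2 : `|q| * `|expR (logJ h x) - (1 + h * dv x)| <= M * (L * L * (e + 1) * h ^+ 2).
    by rewrite ler_pM// /q.
  rewrite /C (ger0_norm M0); lra.
have h4 := Rd_integral_dist Hmu m2 m1 ex.
rewrite (le_trans (ler_distD (Rd_integral mu (pert h V dv g)) _ _))//.
rewrite mulrDl addrC lerD//; first exact: hK1.
by rewrite (le_trans h4)// mulrAC.
Qed.

Lemma transported0 g : transported 0 g = g.
Proof. by apply/funext => x; rewrite /transported X0 logJ0 expR0 mulr1. Qed.

Lemma Rd_integral_transported M r g t : blip M g -> supp_in r g -> 0 <= t ->
  Rd_integral mu (transported t g) = Rd_integral mu g.
Proof.
move=> bg g0 t0.
(* [K] is taken for the class that contains all [transported (k * t / n) g] with [k <= n], hence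
   does not depend on [n]. *)
have [K K0 hK] := Rd_integral_transported_step
  (2 * (M * (1 + growth d L t) *
    (expR (L * t * (1 + growth d L t)) * (1 + L * t * (1 + growth d L t)))))
  (r + L * t).
have step n k : (k <= n.+1)%N -> t <= n.+1%:R ->
  `|Rd_integral mu (transported (k%:R * (t / n.+1%:R)) g) - Rd_integral mu g|
    <= k%:R * (K * (t / n.+1%:R) ^+ 2).
  move=> kn tn; have n0 : 0 < n.+1%:R :> R by rewrite ltr0n.
  set e := t / n.+1%:R.
  have e0 : 0 <= e by rewrite divr_ge0.
  have e1 : e <= 1 by rewrite ler_pdivrMr// mul1r.
  elim: k kn => [|k IH] kn; first by rewrite !mul0r transported0 subrr normr0.
  have ke : 0 <= k%:R * e <= t.
    rewrite mulr_ge0//= /e mulrA ler_pdivrMr// mulrC ler_wpM2l//.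
    by rewrite ler_nat ltnW.
  have := hK _ (transported_blip ke bg) (transported_supp ke g0) e.
  rewrite e0 e1 => /(_ isT) hs.
  have hi := IH (ltnW kn).
  have -> : transported (k.+1%:R * e) g = transported e (transported (k%:R * e) g).
    by apply/funext => x; rewrite -natr1 mulrDl mul1r transported_add.
  rewrite (le_trans (ler_distD (Rd_integral mu (transported (k%:R * e) g)) _ _))//.
  by rewrite -natr1 mulrDl mul1r addrC lerD.
apply/eqP; rewrite -subr_eq0 -normr_le0 leNgt; apply/negP => a0.
set a := `|_| in a0.
(* The first summand makes the step length at most 1, the second makes the accumulated error
   [K * t ^+ 2 / n.+1] smaller than [a]. *)
pose n := (Num.truncn t + Num.truncn (K * t ^+ 2 / a))%N.
have tn : t <= n.+1%:R.
  by apply: (le_trans (ltW (truncnS_gt t))); rewrite ler_nat ltnS leq_addr.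
have := step n n.+1 (leqnn _) tn.
have n0 : n.+1%:R != 0 :> R by rewrite pnatr_eq0.
rewrite [n.+1%:R * (t / _)]mulrC divfK// -/a leNgt => /negP; apply.
have -> : n.+1%:R * (K * (t / n.+1%:R) ^+ 2) = K * t ^+ 2 / n.+1%:R by field.
rewrite ltr_pdivrMr ?ltr0n// [ltRHS]mulrC -ltr_pdivrMr//.
by apply: (lt_le_trans (truncnS_gt _)); rewrite ler_nat ltnS leq_addl.
Qed.

(** * The limit superior of the logarithm of the Jacobian *)

Variable C : R.
Hypothesis logJC : forall t x, 0 <= t -> `|logJ t x| <= C.

Definition tail_sup (n : nat) x : R := sup [set logJ t x | t in [set t | n%:R <= t]].

Lemma tail_has_sup (n : nat) x : has_sup [set logJ t x | t in [set t | n%:R <= t]].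
Proof.
split; first by exists (logJ n%:R x), n%:R => //=.
exists C => _ [t /= nt <-]; have t0 : 0 <= t by exact: le_trans nt.
exact: le_trans (ler_norm _) (logJC x t0).
Qed.

Lemma tail_sup_ub (n : nat) t x : n%:R <= t -> logJ t x <= tail_sup n x.
Proof. by move=> nt; apply: sup_ubound; [case: (tail_has_sup n x)|exists t]. Qed.

Lemma tail_sup_le (n : nat) x (a : R) : (forall t, n%:R <= t -> logJ t x <= a) ->
  tail_sup n x <= a.
Proof.
move=> h; apply: ge_sup; first by case: (tail_has_sup n x).
by move=> _ [t /= nt <-]; exact: h.
Qed.

Lemma tail_sup_abs (n : nat) x : `|tail_sup n x| <= C.
Proof.
rewrite ler_norml; apply/andP; split.
  rewrite (le_trans _ (tail_sup_ub x (lexx n%:R)))//.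
  by have := logJC x (ler0n R n); rewrite ler_norml => /andP[].
apply: tail_sup_le => t nt; have t0 : 0 <= t by exact: le_trans nt.
exact: le_trans (ler_norm _) (logJC x t0).
Qed.

Lemma tail_sup_nonincreasing x : nonincreasing_seq (tail_sup^~ x).
Proof.
move=> m n mn; apply: tail_sup_le => t nt; apply: tail_sup_ub.
by rewrite (le_trans _ nt)// ler_nat.
Qed.

(** The limit superior of [logJ t x] as [t] tends to [+oo], taken along integers so that dominated
    convergence for sequences applies. *)
Definition lsup x : R := limn (tail_sup^~ x).

Lemma tail_sup_cvg x : tail_sup n x @[n --> \oo] --> lsup x.
Proof.
apply: nonincreasing_is_cvgn; first exact: tail_sup_nonincreasing.
exists (- C) => _ [n _ <-].
by have := tail_sup_abs n x; rewrite ler_norml => /andP[].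
Qed.

Lemma lsup_abs x : `|lsup x| <= C.
Proof.
have h : `|tail_sup n x| @[n --> \oo] --> `|lsup x|.
  by apply: cvg_norm; exact: tail_sup_cvg.
rewrite -(cvg_lim (@Rhausdorff R) h); apply: limr_le.
  by apply/cvg_ex; exists `|lsup x|.
by apply: nearW => n; exact: tail_sup_abs.
Qed.

(** By the cocycle identity, [tail_sup n (X s x) + logJ s x] is the supremum of [logJ^~ x] over
    times at least [n + s]. It lies between the tails from [n + m] and from [n] for any integer
    [m >= s], and both have the limit [lsup x]. *)
Lemma lsup_flow s x : 0 <= s -> lsup (X s x) = lsup x - logJ s x.
Proof.
move=> s0.
have Fs t : logJ t (X s x) = logJ (t + s) x - logJ s x by rewrite logJ_add addrAC subrr add0r.
have h1 : tail_sup n (X s x) + logJ s x @[n --> \oo] --> lsup (X s x) + logJ s x.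
  by apply: cvgD; [exact: tail_sup_cvg|exact: cvg_cst].
have [m sm] : exists m : nat, s <= m%:R.
  by exists (Num.truncn s).+1; rewrite ltW// truncnS_gt.
have h2 : tail_sup (n + m)%N x @[n --> \oo] --> lsup x.
  by rewrite (cvg_shiftn m (tail_sup^~ x)); exact: tail_sup_cvg.
apply/eqP; rewrite -subr_eq opprK eq_le; apply/andP; split.
  apply: (ler_cvg_to h1 (@tail_sup_cvg x)); apply: nearW => n.
  rewrite -lerBrDr; apply: tail_sup_le => t nt; rewrite Fs lerD2r tail_sup_ub//.
  by rewrite (le_trans nt)// lerDl.
apply: (ler_cvg_to h2 h1); apply: nearW => n.
apply: tail_sup_le => t; rewrite natrD => nt; rewrite -lerBlDr.
rewrite -[t](subrK s) -Fs tail_sup_ub// lerBrDr (le_trans _ nt)// lerD2l//.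
Qed.

Lemma lsup_translate (e : E) x : (forall y, V (y + e) = V y) ->
  (forall y, dv (y + e) = dv y) -> lsup (x + e) = lsup x.
Proof.
move=> Ve de; rewrite /lsup (_ : tail_sup^~ (x + e) = tail_sup^~ x)//.
apply/funext => n; rewrite /tail_sup; congr sup; apply/seteqP.
by split=> _ [t nt <-]; exists t => //; rewrite logJ_translate.
Qed.

(* Finite maxima approximating the uncountable supremum [tail_sup]: this makes
   [tail_sup] measurable and a bounded limit of Lipschitz functions. *)
Definition grid_max (n k : nat) x : R :=
  \big[Num.max/logJ n%:R x]_(j < (k.+1 ^ 2)%N) logJ (n%:R + j%:R / k.+1%:R) x.

Lemma blip_bigmax (J : Type) (l : seq J) M (f0 : E -> R) (f : J -> E -> R) :
  blip M f0 -> (forall j, blip M (f j)) ->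
  blip M (fun x => \big[Num.max/f0 x]_(j <- l) f j x).
Proof.
move=> b0 bf; elim: l => [|j l IH].
  by rewrite (_ : (fun x => _) = f0)//; apply/funext => x; rewrite big_nil.
rewrite (_ : (fun x => _) = fun x => Num.max (f j x) (\big[Num.max/f0 x]_(j <- l) f j x)).
  exact: blip_max.
by apply/funext => x; rewrite big_cons.
Qed.

(** With [k.+1 ^ 2] nodes and mesh [1 / k.+1], the grid becomes longer and finer at the same
    time. *)
Lemma grid_time (k j : nat) : (j < k.+1 ^ 2)%N -> 0 <= (j%:R : R) / k.+1%:R <= k.+1%:R.
Proof.
move=> jk; rewrite divr_ge0//= ler_pdivrMr ?ltr0n//.
by rewrite -natrM ler_nat ltnW.
Qed.

Lemma grid_max_blip n k : exists M, blip M (grid_max n k).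
Proof.
exists (L * (n%:R + k.+1%:R) * (1 + growth d L (n%:R + k.+1%:R))).
apply: (@blip_bigmax _ _ _ _ (fun j : 'I_(k.+1 ^ 2) => logJ (n%:R + j%:R / k.+1%:R))) => [|j].
  by apply: logJ_blip; rewrite ler0n/= lerDl.
by apply: logJ_blip; have /andP[h1 h2] := grid_time (ltn_ord j); rewrite addr_ge0//= lerD2l.
Qed.

Lemma grid_max_le n k x (a : R) : logJ n%:R x <= a ->
  (forall j : nat, (j < k.+1 ^ 2)%N -> logJ (n%:R + j%:R / k.+1%:R) x <= a) ->
  grid_max n k x <= a.
Proof. by move=> h0 h; apply/bigmax_leP; split=> // j _; exact: h. Qed.

Lemma grid_max_ge n k j x : (j < k.+1 ^ 2)%N ->
  logJ (n%:R + j%:R / k.+1%:R) x <= grid_max n k x.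
Proof.
move=> jk.
exact: (le_bigmax _ (fun j : 'I_(k.+1 ^ 2)%N => logJ (n%:R + j%:R / k.+1%:R) x) (Ordinal jk)).
Qed.

Lemma grid_max_abs n k x : `|grid_max n k x| <= C.
Proof.
have h t : 0 <= t -> - C <= logJ t x <= C by move=> /(logJC x); rewrite ler_norml.
have k0 : (0 < k.+1 ^ 2)%N by rewrite expn_gt0.
rewrite ler_norml; apply/andP; split.
  apply: le_trans (grid_max_ge n x k0); have /andP[e0 _] := grid_time k0.
  by have /andP[] : - C <= logJ (n%:R + 0%:R / k.+1%:R) x <= C by apply: h; rewrite addr_ge0.
apply: grid_max_le; first by have /andP[] := h n%:R (ler0n _ _).
move=> j jk; have /andP[e0 _] := grid_time jk.
by have /andP[] : - C <= logJ (n%:R + j%:R / k.+1%:R) x <= C by apply: h; rewrite addr_ge0.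
Qed.

Lemma grid_max_cvg n x : grid_max n k x @[k --> \oo] --> tail_sup n x.
Proof.
apply/cvgrPdist_le => e e0; have e20 : 0 < e / 2 by rewrite divr_gt0.
have [_ [t /= nt <-] ht] := sup_adherent e20 (tail_has_sup n x).
(* The first summand makes the grid reach past the almost maximal time [t], the second brings the
   oscillation of [logJ] over one mesh below [e / 2]. *)
pose K := (Num.truncn (t - n%:R) + Num.truncn (L / (e / 2)))%N.
exists K => // k /= Kk.
have k0 : 0 < k.+1%:R :> R by rewrite ltr0n.
have tk : t - n%:R < k.+1%:R.
  by apply: (lt_le_trans (truncnS_gt _)); rewrite ler_nat ltnS (leq_trans _ Kk)// leq_addr.
have Lk : L / k.+1%:R <= e / 2.
  rewrite ler_pdivrMr// mulrC -ler_pdivrMr// ltW//.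
  by apply: (lt_le_trans (truncnS_gt _)); rewrite ler_nat ltnS (leq_trans _ Kk)// leq_addl.
pose j := Num.truncn ((t - n%:R) * k.+1%:R).
have tn0 : 0 <= (t - n%:R) * k.+1%:R by rewrite mulr_ge0// subr_ge0.
have /andP[j1 j2] := truncn_itv tn0; rewrite -/j in j1 j2.
have jk : (j < k.+1 ^ 2)%N.
  by rewrite -(ltr_nat R) (le_lt_trans j1)// -mulnn natrM ltr_pM2r.
have le1 : grid_max n k x <= tail_sup n x.
  apply: grid_max_le => [|i ik]; apply: tail_sup_ub => //.
  by rewrite lerDl; have /andP[] := grid_time ik.
have le2 := grid_max_ge n x jk.
have dt : `|t - (n%:R + j%:R / k.+1%:R)| <= k.+1%:R^-1.
  have a1 : j%:R / k.+1%:R <= t - n%:R by rewrite ler_pdivrMr.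
  have a2 : t - n%:R < j%:R / k.+1%:R + k.+1%:R^-1.
    rewrite [ltRHS](_ : _ = j.+1%:R / k.+1%:R); first by rewrite ltr_pdivlMr.
    by rewrite -[in RHS]natr1 mulrDl mul1r.
  move: a1 a2; set p := j%:R / _; set q := _^-1 => a1 a2.
  by rewrite ger0_norm; lra.
have h1 := le_trans (logJ_dist t (n%:R + j%:R / k.+1%:R) x) (le_trans (ler_wpM2l L0 dt) Lk).
have h2 := le_trans (ler_norm _) h1.
rewrite -/(tail_sup n x) in ht.
rewrite ger0_norm ?subr_ge0//.
move: h2 ht le2; set p := logJ _ x; set q := logJ _ x; lra.
Qed.

Definition sigma x := expR (lsup x).

(** * Invariance of the density under the flow, tested against functions *)

Section Duality.
Variables (s : R) (s0 : 0 <= s) (M r : R) (phi : E -> R).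
Hypothesis bphi : blip M phi.
Hypothesis phi0 : supp_in r phi.

(* Liouville's formula for [expR (w x) * phi (X (- s) x)]; this class of [w]
   contains the Lipschitz functions and is closed under pointwise limits. *)
Let dual (w : E -> R) := [/\ measurable_fun [set: T] (w : T -> R),
  measurable_fun [set: T] ((w \o X s) : T -> R), (forall x, `|w x| <= C) &
  Rd_integral mu (fun x => expR (w x) * phi (X (- s) x)) =
  Rd_integral mu (fun x => expR (w (X s x)) * phi x * expR (logJ s x))].

Let bphiX : blip (M * (1 + growth d L (- s))) (phi \o X (- s)).
Proof.
apply: (blip_comp (T := X (- s))) bphi => [|x y]; [exact: growth_ge0|exact: flow_lip].
Qed.

Let phiX0 : supp_in (r + L * s) (phi \o X (- s)).
Proof. by apply: supp_comp phi0 => x; exact: flow_distN. Qed.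

Let expR_bound (w : E -> R) : (forall x, `|w x| <= C) -> forall x, `|expR (w x)| <= expR C.
Proof.
by move=> wC x; rewrite ger0_norm ?expR_ge0// ler_expR (le_trans (ler_norm _)).
Qed.

Let mbs_left w : measurable_fun [set: T] (w : T -> R) -> (forall x, `|w x| <= C) ->
  mbs (expR C * M) (r + L * s) (fun x => expR (w x) * phi (X (- s) x)).
Proof.
move=> mw wC; split=> [|x|x rx].
- apply: measurable_funM; first exact: measurableT_comp.
  by apply: continuous_measurable_Rd; exact: blip_continuous bphiX.
- by rewrite normrM ler_pM//; [exact: expR_bound|case: bphi => + _; exact].
- by have /= -> := phiX0 rx; rewrite mulr0.
Qed.

Let mbs_right w : measurable_fun [set: T] ((w \o X s) : T -> R) ->
  (forall x, `|w x| <= C) ->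
  mbs (expR C * M * expR C) r (fun x => expR (w (X s x)) * phi x * expR (logJ s x)).
Proof.
move=> mw wC; split=> [|x|x rx].
- apply: measurable_funM; first apply: measurable_funM.
  + exact: (measurableT_comp (@measurable_expR R) mw).
  + by apply: continuous_measurable_Rd; exact: blip_continuous bphi.
  + apply: continuous_measurable_Rd.
    have ss : 0 <= s <= s by rewrite s0 lexx.
    exact: (blip_continuous (blip_expR (logJ_blip ss))).
- rewrite !normrM ler_pM//; last by apply: expR_bound => y; exact: logJC.
  by rewrite ler_pM//; [exact: (expR_bound wC)|case: bphi => + _; exact].
- by rewrite (phi0 rx) mulr0 mul0r.
Qed.

(** The bound [|w| <= C] dominates both sides. Measurability of [w \o X s] is carried along in
    [dual] and passes to pointwise limits by itself, instead of being derived from measurability of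
    the map [X s]. *)
Let dual_cvg (W : nat -> E -> R) w : (forall k, dual (W k)) ->
  (forall x, W k x @[k --> \oo] --> w x) -> dual w.
Proof.
move=> dW Ww.
have mw : measurable_fun [set: T] (w : T -> R).
  by apply: (@measurable_fun_cvg _ T R setT W) => // n; case: (dW n).
have mwX : measurable_fun [set: T] ((w \o X s) : T -> R).
  apply: (@measurable_fun_cvg _ T R setT (fun k => W k \o X s)) => [n|x _].
    by case: (dW n).
  exact: (Ww (X s x)).
have wC x : `|w x| <= C.
  have h : `|W k x| @[k --> \oo] --> `|w x| by apply: cvg_norm; exact: Ww.
  rewrite -(cvg_lim (@Rhausdorff R) h); apply: limr_le.
    by apply/cvg_ex; exists `|w x|.
  by apply: nearW => n; case: (dW n) => _ _ + _; exact.
have eW x : expR (W k x) @[k --> \oo] --> expR (w x).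
  exact: (continuous_cvg _ (@continuous_expR R _) (Ww x)).
split=> //.
have c1 : Rd_integral mu (fun x => expR (W k x) * phi (X (- s) x)) @[k --> \oo] -->
    Rd_integral mu (fun x => expR (w x) * phi (X (- s) x)).
  apply: (Rd_integral_cvg Hmu (M := expR C * M) (r := r + L * s)) => [k|x].
    by apply: mbs_left; case: (dW k).
  by apply: cvgMl; exact: eW.
have c2 : Rd_integral mu (fun x => expR (W k (X s x)) * phi x * expR (logJ s x)) @[k --> \oo] -->
    Rd_integral mu (fun x => expR (w (X s x)) * phi x * expR (logJ s x)).
  apply: (Rd_integral_cvg Hmu (M := expR C * M * expR C) (r := r)) => [k|x].
    by apply: mbs_right; case: (dW k).
  by apply: cvgMl; apply: cvgMl; exact: eW.
have e : (fun k => Rd_integral mu (fun x => expR (W k x) * phi (X (- s) x))) =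
    (fun k => Rd_integral mu (fun x => expR (W k (X s x)) * phi x * expR (logJ s x))).
  by apply/funext => k; case: (dW k).
rewrite e in c1.
exact: (cvg_unique (@Rhausdorff R) c1 c2).
Qed.

(** Liouville's formula for the function [expR w * (phi \o X (- s))]: composition with [X s] turns
    its second factor into [phi]. *)
Let dual_blip K w : blip K w -> (forall x, `|w x| <= C) -> dual w.
Proof.
move=> bw wC; split=> //.
- by apply: continuous_measurable_Rd; exact: blip_continuous bw.
- apply: continuous_measurable_Rd.
  have bwX := blip_comp (growth_ge0 d L s) (flow_lip s) bw.
  exact: blip_continuous bwX.
have h := Rd_integral_transported (blipM (blip_expR bw) bphiX) _ s0.
rewrite -(h (r + L * s)); last by move=> x rx; have /= -> := phiX0 rx; rewrite mulr0.
congr (Rd_integral mu _); apply/funext => x.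
by rewrite /transported /= -flow_add addNr X0.
Qed.

(** [lsup] is reached from Lipschitz functions by two successive limits, first in the grid and then
    in the tail. [lsup_flow] then cancels the Jacobian on the right-hand side. *)
Lemma Rd_integral_sigma_flow : Rd_integral mu (fun x => sigma x * phi (X (- s) x)) =
  Rd_integral mu (fun x => sigma x * phi x).
Proof.
have [_ _ _] : dual lsup.
  apply: (@dual_cvg tail_sup) => [n|x]; last exact: tail_sup_cvg.
  apply: (@dual_cvg (grid_max n)) => [k|x]; last exact: grid_max_cvg.
  have [K bK] := grid_max_blip n k.
  by apply: dual_blip bK _ => x; exact: grid_max_abs.
rewrite /sigma => ->; congr (Rd_integral mu _); apply/funext => x.
by rewrite lsup_flow// expRB mulrAC divfK// gt_eqF// expR_gt0.
Qed.

End Duality.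

Lemma measurable_sigma : measurable_fun [set: T] (sigma : T -> R).
Proof.
apply: measurableT_comp => //.
apply: (@measurable_fun_cvg _ T R setT tail_sup) => [n|x _]; last exact: tail_sup_cvg.
apply: (@measurable_fun_cvg _ T R setT (grid_max n)) => [k|x _]; last exact: grid_max_cvg.
have [K bK] := grid_max_blip n k.
by apply: continuous_measurable_Rd; exact: blip_continuous bK.
Qed.

Lemma sigma_abs x : `|sigma x| <= expR C.
Proof. by rewrite ger0_norm ?expR_ge0// ler_expR (le_trans (ler_norm _))// lsup_abs. Qed.

Lemma mbs_sigma M r (f : E -> R) : blip M f -> supp_in r f ->
  mbs (expR C * M) r (fun x => sigma x * f x).
Proof.
move=> bf f0; split=> [|x|x sx].
- apply: measurable_funM; first exact: measurable_sigma.
  by apply: continuous_measurable_Rd; exact: blip_continuous bf.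
- by rewrite normrM ler_pM// ?sigma_abs//; case: bf => + _; exact.
- by rewrite f0// mulr0.
Qed.

(** Here [psi] is the derivative of [phi] along the flow, and [phi (X (- s) x) = phi x - s * psi x]
    up to [O(s^2)]. Integrated against [sigma], the terms in [phi] cancel by invariance, leaving
    [s * |int sigma psi| <= K * s ^+ 2] for small [s]. *)
Lemma Rd_integral_sigma_derive M P r (phi psi : E -> R) :
  blip M phi -> supp_in r phi -> blip P psi -> supp_in r psi ->
  (forall x (t : R), is_derive t 1 (fun s => phi (X s x)) (psi (X t x))) ->
  Rd_integral mu (fun x => sigma x * psi x) = 0.
Proof.
move=> bphi phi0 bpsi psi0 dphi.
have P0 := blip_ge0 bpsi; have M0 := blip_ge0 bphi; have Lp := L0.
pose K := expR C * (P * L) * vol mu (r + L).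
have K0 : 0 <= K.
  apply: mulr_ge0; last exact: vol_ge0.
  by apply: mulr_ge0; [exact: expR_ge0|exact: mulr_ge0].
have key s : 0 < s -> s <= 1 -> s * `|Rd_integral mu (fun x => sigma x * psi x)| <= K * s ^+ 2.
  move=> s0 s1.
  have s0' := ltW s0.
  have bA := blip_comp (T := X (- s)) (growth_ge0 d L (- s)) (flow_lip (- s)) bphi.
  have A0 : supp_in (r + L) (phi \o X (- s)).
    apply: supp_comp phi0 => x; rewrite (le_trans (flow_distN x s0'))//.
    by rewrite ler_piMr.
  have mA := mbs_sigma bA A0.
  have rL : r <= r + L by rewrite lerDl.
  have m1 := mbs_le (lexx _) rL (mbs_sigma bphi phi0).
  have m2 := mbs_le (lexx _) rL (mbs_sigma bpsi psi0).
  have m3 : mbs (s * (expR C * P)) (r + L) (fun x => s * (sigma x * psi x)).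
    case: m2 => mf mb mz; split=> [|x|x rx].
    - by apply: measurable_funM.
    - by rewrite normrM (ger0_norm s0') ler_wpM2l.
    - by rewrite mz// mulr0.
  have m4 := mbsB m1 m3.
  have := Rd_integral_dist Hmu mA m4 (C := expR C * (P * L) * s ^+ 2) _.
  rewrite (Rd_integral_sub Hmu m1 m3) (Rd_integral_scale Hmu _ m2) /=.
  rewrite (Rd_integral_sigma_flow s0' bphi phi0) opprB addrCA subrr addr0 normrM (ger0_norm s0').
  move=> h; rewrite /K mulrAC; apply: h => x.
  rewrite -[s * (_ * _)]mulrCA -mulrBr -mulrBr normrM -mulrA.
  rewrite ler_pM ?sigma_abs//.
  have dc (t : R) : is_derive t 1 (fun t => phi (X t x) - t * psi x) (psi (X t x) - psi x).
    have h1 := is_deriveM (is_derive_id t (1 : R)) (is_derive_cst (psi x) t (1 : R)).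
    apply: (is_derive_eq (is_deriveB (dphi x t) h1)).
    by rewrite scaler0 add0r [_ *: 1]mulr1.
  have ns : - s <= 0 by rewrite oppr_le0.
  have [_ psi2] := bpsi.
  have := @MVT_le _ _ _ (- s) 0 (P * (L * s)) ns dc.
  rewrite X0 mul0r subr0 sub0r opprK mulNr opprK distrC.
  have -> : P * L * s ^+ 2 = P * (L * s) * s by ring.
  rewrite (_ : phi (X (- s) x) + s * psi x - phi x =
    phi (X (- s) x) - (phi x - s * psi x)); last by ring.
  apply=> t /andP[t1 t2]; rewrite (le_trans (psi2 _ _))// ler_wpM2l//.
  rewrite -[t]opprK (le_trans (flow_distN x _)) ?oppr_ge0// ler_wpM2l//.
  by rewrite lerNl.
apply/eqP; rewrite -normr_le0 leNgt; apply/negP => a0.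
set a := `|_| in a0 key.
have K1 : 0 < K + a by rewrite ltr_wpDl.
(* This choice gives [s <= 1] and [K * s < a]; adding [a] in the denominator covers [K = 0]. *)
pose s := a / (2 * (K + a)).
have s0 : 0 < s by rewrite divr_gt0// mulr_gt0.
have s1 : s <= 1 by rewrite ler_pdivrMr ?mulr_gt0// mul1r; lra.
have := key s s0 s1; rewrite (_ : K * s ^+ 2 = s * (K * s)); last by ring.
rewrite ler_pM2l// /s mulrA ler_pdivlMr ?mulr_gt0// leNgt => /negP; apply.
by rewrite [ltLHS]mulrC ltr_pM2l//; lra.
Qed.

End Flow.

(** * Gradient flows *)

Section GradientFlow.
Variables (R : realType) (d : nat).
Local Notation E := 'rV[R]_d.
Implicit Types (f phi u : E -> R).

Lemma blip_uniform (f : 'I_d -> E -> R) : (forall i, exists2 M, 0 <= M & blip M (f i)) ->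
  exists2 M, 0 <= M & forall i, blip M (f i).
Proof.
move=> h; have h' i : exists M, 0 <= M /\ blip M (f i).
  by have [N N0 fN] := h i; exists N.
have [M hM] := choice h'.
exists (\sum_i M i); first by apply: sumr_ge0 => i _; case: (hM i).
move=> i; apply: blip_le (proj2 (hM i)); rewrite (bigD1 i)//= lerDl sumr_ge0// => k _.
by case: (hM k).
Qed.

Lemma blip_sum (M : R) (l : seq 'I_d) (f : 'I_d -> E -> R) :
  (forall i, blip M (f i)) ->
  blip ((size l)%:R * M) (fun x => \sum_(i <- l) f i x).
Proof. by move=> bf; exact: (blip_divf bf). Qed.

Lemma supp_in_partial r phi i : supp_in r phi -> supp_in r (partial i phi).
Proof.
move=> phi0 x rx; rewrite /partial.
rewrite (@near_eq_derive _ _ _ phi (cst 0)) ?derive_cst//.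
apply/(@nbhs_ballP _ E); exists (`|x| - r); first by rewrite /= subr_gt0.
move=> y; rewrite -ball_normE/= => xy; apply: phi0.
by have := ler_normD (x - y) y; rewrite subrK; lra.
Qed.

Lemma supp_continuous_bounded r f : continuous f -> supp_in r f ->
  exists2 M, 0 <= M & forall x, `|f x| <= M.
Proof.
move=> cf f0.
have K : compact [set x : E | `|x| <= `|r|].
  apply: bounded_closed_compact.
    by exists `|r|; split=> // M M1 x /= /le_trans; apply; exact: ltW.
  apply: (@closed_comp _ _ (fun x : E => `|x|) [set t : R | t <= `|r|]).
    by move=> x _; exact: norm_continuous.
  exact: closed_le.
have K0 : [set x : E | `|x| <= `|r|] !=set0 by exists 0 => /=; rewrite normr0.
have [|c _ hc] := @EVT_max_rV R d (fun x => `|f x|) _ K0 K.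
  apply: continuous_subspaceT => x; apply: continuous_comp; first exact: cf.
  exact: norm_continuous.
exists `|f c| => // x; have [xr|xr] := leP `|x| `|r|; first by apply: hc; rewrite inE.
by rewrite f0 ?normr0// (le_lt_trans _ xr)// ler_norm.
Qed.

Lemma supp_Ck1_blip r f : Ck 1 f -> supp_in r f -> exists2 M, 0 <= M & blip M f.
Proof.
move=> [cf df] f0; have [M M0 fM] := supp_continuous_bounded cf f0.
apply: (Ck1_bounded_blip M0 fM df) => i; have [_ ci] := df i.
exact: supp_continuous_bounded ci (supp_in_partial i f0).
Qed.

Lemma grad_field u x : grad u x = field (fun i => partial i u) (index_enum 'I_d) x.
Proof.
apply/rowP => j; rewrite mxE /field summxE (bigD1 j)//= big1 ?addr0.
  by rewrite mxE evecE eqxx mulr1.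
by move=> i ij; rewrite mxE evecE eq_sym (negbTE ij) mulr0.
Qed.

(** * Bounds on the gradient field, and the converse statement *)

Variables (u : E -> R) (X : R -> E -> E).
Hypothesis Hu : Ck 3 u.
Hypothesis Hper : Yperiodic (grad u).
Hypothesis HX : is_gradient_flow u X.

Let b i := partial i u.
Let db i := partial i (partial i u).

Lemma Yperiodic_b i : Yperiodic (b i).
Proof. by move=> j x; have /rowP/(_ i) := Hper j x; rewrite !mxE. Qed.

Lemma Ck2_b i : Ck 2 (b i).
Proof. by case: Hu => _ /(_ i)[]. Qed.

Lemma Ck1_b i : Ck 1 (b i).
Proof. 
case: (Ck2_b i) => c h; split=> // j; have [h1 [h2 _]] := h j.
by split.
Qed.

(** This is where [C^3] and periodicity enter: the second derivatives of [u] are still [C^1], and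
    periodicity of the gradient makes all the derivatives involved globally bounded. *)
Lemma gradient_bounds : exists N, [/\ forall i, blip N (b i) & forall i, blip N (db i)].
Proof.
have [N1 N10 h1] : exists2 M, 0 <= M & forall i, blip M (b i).
  by apply: blip_uniform => i; exact: Yperiodic_Ck1_blip (Ck1_b i) (@Yperiodic_b i).
have [N2 N20 h2] : exists2 M, 0 <= M & forall i, blip M (db i).
  apply: blip_uniform => i; apply: Yperiodic_Ck1_blip.
    by case: (Ck2_b i) => _ /(_ i)[].
  exact/Yperiodic_partial/Yperiodic_b.
exists (N1 + N2); split=> i; first by apply: blip_le (h1 i); rewrite lerDl.
by apply: blip_le (h2 i); rewrite lerDr.
Qed.

Lemma is_derive_b i x : is_derive x (evec R i) (b i) (db i x).
Proof. by case: (Ck2_b i) => _ /(_ i)[+ _] => /(_ x) h; exact: DeriveDef. Qed.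

Lemma Yperiodic_field : Yperiodic (field b (index_enum 'I_d)).
Proof. by move=> i x; rewrite -!(grad_field u); exact: Hper. Qed.

Lemma Yperiodic_divf : Yperiodic (divf db (index_enum 'I_d)).
Proof.
move=> i x; apply: eq_bigr => j _.
exact: (@Yperiodic_partial _ _ j (b j) (@Yperiodic_b j)).
Qed.

Lemma flow0 x : X 0 x = x. Proof. by case: (HX x). Qed.

Lemma is_derive_flow x (t : R) :
  is_derive t 1 (fun s => X s x) (field b (index_enum 'I_d) (X t x)).
Proof. by have [_ /(_ t)] := HX x; rewrite grad_field. Qed.

Lemma continuous_laplacian_flow x : continuous (fun s => laplacian u (X s x)).
Proof.
have [N [_ bdb]] := gradient_bounds.
move=> s; apply: (@continuous_comp _ _ _ (fun s => X s x) (laplacian u)).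
  apply: differentiable_continuous; apply/derivable1_diffP.
  by have [] := is_derive_flow x s.
have h : continuous (laplacian u) by exact: blip_continuous (blip_divf bdb _).
exact: h.
Qed.

(** Expanding the divergence gives [sE], whose second term vanishes at critical points. The integral
    along an orbit is a difference of two values of [ln sigma], which is bounded because [sigma] is
    continuous, positive and periodic. *)
Lemma bounded_laplacian_flow (sigma : E -> R) :
  [/\ forall x, 0 < sigma x, Yperiodic sigma, Ck 1 sigma &
      forall x, \sum_(i < d) partial i (fun y => sigma y * partial i u y) x = 0] ->
  (forall x, grad u x = 0 -> laplacian u x = 0) /\
  (exists C : R, 0 < C /\ forall (t : R) (x : E), 0 <= t ->
     `| Rintegral lebesgue_measure `[0, t]%classic
          (fun s => laplacian u (X s x)) | <= C).
Proof.
move=> [s0 ps cs divs].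
have sE x : sigma x * laplacian u x + dotv (grad sigma x) (grad u x) = 0.
  rewrite -(divs x) /laplacian mulr_sumr /dotv -big_split/=; apply: eq_bigr => i _.
  have [_ /(_ i)[ds _]] := cs.
  have [_ /(_ i)[du _]] := Ck2_b i.
  rewrite {3}/partial deriveM//.
  by rewrite /= !mxE /partial /GRing.scale/= [X in _ + X]mulrC.
split=> [x gx|].
  have := sE x; rewrite gx /dotv big1 ?addr0.
    by move=> /eqP; rewrite mulf_eq0 gt_eqF//= => /eqP.
  by move=> i _; rewrite !mxE mulr0.
have cln : continuous (fun x => ln (sigma x)).
  move=> x; apply: (@continuous_comp _ _ _ sigma (@ln R)).
    by case: cs => + _; exact.
  exact: continuous_ln.
have pln : Yperiodic (fun x => ln (sigma x)) by move=> i x; rewrite ps.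
have [B B0 hB] := Yperiodic_bounded cln pln.
(* Each of the two values of [ln sigma] contributes [B]; the 1 makes the constant strictly
   positive. *)
exists (2 * B + 1); split=> [|t x t0]; first by lra.
rewrite (Rintegral_prim (@continuous_laplacian_flow x))//.
have dQ (y : R) : is_derive y 1 (fun t => - ln (sigma (X t x))) (laplacian u (X y x)).
  have h1 := is_derive_curve cs (is_derive_flow x y).
  have h2 := @is_derive1_comp _ (@ln R) (fun t => sigma (X t x)) y _ _
    (is_derive1_ln (s0 (X y x))) h1.
  apply: (is_derive_eq (is_deriveN h2)).
  have /eqP := sE (X y x); rewrite (grad_field u) addr_eq0 => /eqP h.
  by rewrite -[dotv _ _]opprK -h mulrN opprK mulKf// gt_eqF.
rewrite (primE t dQ (@continuous_laplacian_flow x)) opprK.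
have := ler_normD (- ln (sigma (X t x))) (ln (sigma (X 0 x))).
rewrite normrN; have := hB (X t x); have := hB (X 0 x); lra.
Qed.

End GradientFlow.

Theorem theorem5p2 (R : realType) (d : nat) (hd : (2 <= d)%N)
  (mu : {measure set Rd_meas R d -> \bar R}) (Hmu : is_lebesgue_Rd mu)
  (u : 'rV[R]_d -> R) (X : R -> 'rV[R]_d -> 'rV[R]_d)
  (Hu : Ck 3 u) (Hper : Yperiodic (grad u))
  (HX : is_gradient_flow u X)
  (Horb : {ae mu, forall x : Rd_meas R d,
            bounded_set [set X t x | t in [set t : R | 0 <= t]] \/
            bounded_set [set X t x | t in [set t : R | t <= 0]]}) :
  ((* (i) *)
   ((forall x, grad u x = 0 -> laplacian u x = 0) ->
    (exists C : R, 0 < C /\ forall (t : R) (x : 'rV[R]_d), 0 <= t ->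
       `| Rintegral lebesgue_measure `[0, t]%classic
            (fun s => laplacian u (X s x)) | <= C) ->
    exists sigma : 'rV[R]_d -> R,
      [/\ (forall x, 0 < sigma x) /\ Yperiodic sigma,
          measurable_fun [set: Rd_meas R d] (sigma : Rd_meas R d -> R),
          (exists M : R, {ae mu, forall x : Rd_meas R d, `|sigma x| <= M}),
          (exists M : R, {ae mu, forall x : Rd_meas R d, `|(sigma x)^-1| <= M}) &
          forall phi : 'rV[R]_d -> R, Cinf phi -> compact_support phi ->
            (\int[mu]_(x in [set: Rd_meas R d])
               (sigma x * dotv (grad u x) (grad phi x))%:E = 0)%E])
  /\
   (* (ii) *)
   ((exists sigma : 'rV[R]_d -> R,
       [/\ forall x, 0 < sigma x, Yperiodic sigma, Ck 1 sigma &
           forall x, \sum_(i < d)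
              partial i (fun y => sigma y * partial i u y) x = 0]) ->
    (forall x, grad u x = 0 -> laplacian u x = 0) /\
    (exists C : R, 0 < C /\ forall (t : R) (x : 'rV[R]_d), 0 <= t ->
       `| Rintegral lebesgue_measure `[0, t]%classic
            (fun s => laplacian u (X s x)) | <= C))).
Proof.
split; last by move=> [sigma hs]; exact: bounded_laplacian_flow Hu Hper HX sigma hs.
move=> _ [C [C0 hC]].
have [N [bb bdb]] := gradient_bounds Hu Hper.
have dbP := is_derive_b Hu.
have X0 := flow0 HX.
have dX := is_derive_flow HX.
pose b i := partial i u; pose db i := partial i (partial i u).
have logJC t x : 0 <= t -> `|logJ db X t x| <= C.
  (* [divf db (index_enum 'I_d)] unfolds to [laplacian u], so the hypothesis on the integral of the
     Laplacian is the bound on [logJ]. *)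
  move=> t0; rewrite -[logJ db X t x]Rintegral_prim//; first exact: hC.
  exact: (continuous_laplacian_flow Hu Hper HX).
exists (sigma db X); split.
- split=> [x|i x]; first exact: expR_gt0.
  have h := lsup_translate bb bdb X0 dX x (Yperiodic_field Hper i) (Yperiodic_divf Hper i).
  exact: (congr1 expR h).
- exact: (measurable_sigma bb bdb X0 dX logJC).
- exists (expR C); apply: aeW => x; exact: (sigma_abs logJC).
- exists (expR C); apply: aeW => x.
  rewrite /sigma -expRN ger0_norm ?expR_ge0// ler_expR.
  by rewrite (le_trans (ler_norm _))// normrN (lsup_abs logJC).
move=> phi sphi [r phi0].
have [M M0 bphi] := supp_Ck1_blip (sphi 1%N) phi0.
have [P _ bP] : exists2 P, 0 <= P & forall i, blip P (partial i phi).
  apply: blip_uniform => i; apply: supp_Ck1_blip (supp_in_partial i phi0).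
  by have [_ /(_ i)[_]] := sphi 2%N.
pose psi x := dotv (grad u x) (grad phi x).
have bpsi : blip ((size (index_enum 'I_d))%:R * (2 * (N * P))) psi.
  have := blip_sum (index_enum 'I_d) (fun i => blipM (bb i) (bP i)).
  congr blip; apply/funext => x.
  by rewrite /psi /dotv; apply: eq_bigr => i _; rewrite !mxE.
have psi0 : supp_in r psi.
  move=> x rx; rewrite /psi /dotv big1// => i _.
  by rewrite !mxE (supp_in_partial i phi0 rx) mulr0.
have dphi x (t : R) : is_derive t 1 (fun s => phi (X s x)) (psi (X t x)).
  apply: (is_derive_eq (is_derive_curve (sphi 1%N) (dX x t))).
  by rewrite -(grad_field u) /psi /dotv; apply: eq_bigr => i _; rewrite mulrC.
have int0 := Rd_integral_sigma_derive Hmu bb bdb dbP X0 dX logJC bphi phi0 bpsi psi0 dphi.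
have mpsi := mbs_sigma bb bdb X0 dX logJC bpsi psi0.
(* [Rd_integral] is the [fine] part of the extended integral in the goal, and finiteness is what
   allows passing back from it. *)
have fin := integrable_fin_num measurableT (mbs_integrable Hmu mpsi).
by rewrite -(fineK fin) -[fine _]/(Rd_integral mu (fun x => sigma db X x * psi x)) int0.
Qed.
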